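(* Let $G=(V,E)$ be a packing graph with $V$ compact and metrizable. Then for every integer $r\ge1$, $$\mathrm M_{r+1}(G)\le\mathrm{blockM}_{r+2}(G)\le\vartheta(G,C_r(V)_{\mathrm c}^* ).$$ In particular, $\alpha(G)=\mathrm{blockM}_r(G)=\mathrm M_{r-1}(G)$ for all $r\ge\alpha(G)+2$.
   Context: A packing graph is a graph $G=(V,E)$ with $V$ a (Hausdorff) topological space such that every finite clique is contained in an open clique (every single vertex is a clique). $\alpha(G)$ is the maximum cardinality of an independent set (finite when $V$ is compact). $E$ is also viewed as the set $\{(x,y)\in V^2:xy\in E\}$, which is open in $V^2$. $\mathrm{Sub}_r(V)$ is the set of subsets of $V$ of cardinality at most $r$, including $\emptyset$; $\mathrm{Sub}_r(V)\setminus\{\emptyset\}$ has the quotient topology under $(v_1,\dots,v_r)\mapsto\{v_1,\dots,v_r\}$, and $\emptyset$ is an isolated point. $\mathcal I_r\subseteq\mathrm{Sub}_r(V)$ is the subspace of independent sets of cardinality at most $r$, and $\mathcal I_{=r}$ those of cardinality exactly $r$. $M(X)$ denotes the signed Radon measures on a compact Hausdorff space $X$, in duality with $C(X)$ by $\langle f,\nu\rangle=\int f\,d\nu$; $M(X)_{\ge0}$ are the nonnegative ones. $C_{\mathrm{sym}}(X)$, $M_{\mathrm{sym}}(X)$ are the continuous functions, resp. signed Radon measures, on $X^2$ invariant under swapping coordinates; $M_{\mathrm{sym}}(X)_{\succeq0}$ are those $\nu$ with $\langle F,\nu\rangle\ge0$ for every positive-semidefinite kernel $F\in C_{\mathrm{sym}}(X)$.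 $C_{\mathrm{sym}}(\mathcal I_1^2\times\mathcal I_{s})$ and $M_{\mathrm{sym}}(\mathcal I_1^2\times\mathcal I_{s})$ are the continuous functions, resp. signed Radon measures, on $\mathcal I_1^2\times\mathcal I_s$ invariant under swapping the first two coordinates; $C_{\mathrm{sym}}(\mathcal I_1^2\times\mathcal I_s)_{\succeq0}$ is the cone of those $F$ for which $(J,J')\mapsto F(J,J',Q)$ is positive semidefinite for every $Q\in\mathcal I_s$, and $M_{\mathrm{sym}}(\mathcal I_1^2\times\mathcal I_s)_{\succeq0}$ is its dual cone. Moment hierarchy ($r\ge1$): let $A_r:C_{\mathrm{sym}}(\mathcal I_r)\to C(\mathcal I_{2r})$, $A_rF(I)=\sum_{J,J'\in\mathcal I_r,\ J\cup J'=I}F(J,J')$ (a bounded operator, with adjoint $A_r^*$). $\mathrm M_r(G)$ is the supremum of $\nu(\mathcal I_{=1})$ over $\nu\in M(\mathcal I_{2r})_{\ge0}$ with $\nu(\{\emptyset\})=1$ and $A_r^*\nu\in M_{\mathrm{sym}}(\mathcal I_r)_{\succeq0}$. Block moment hierarchy ($r\ge2$): let $B_r:C_{\mathrm{sym}}(\mathcal I_1^2\times\mathcal I_{r-2})\to C(\mathcal I_r)$, $B_rF(I)=\sum_{Q\subseteq I,\,|Q|\le r-2}\ \sum_{J,J'\subseteq I,\ |J|,|J'|\le1,\ Q\cup J\cup J'=I}F(J,J',Q)$ (a bounded operator, with adjoint $B_r^*$). $\mathrm{blockM}_r(G)$ is the supremum of $\nu(\mathcal I_{=1})$ over $\nu\in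 M(\mathcal I_r)_{\ge0}$ with $\nu(\{\emptyset\})=1$ and $B_r^*\nu\in M_{\mathrm{sym}}(\mathcal I_1^2\times\mathcal I_{r-2})_{\succeq0}$. Completely positive hierarchy: for $F\in C_{\mathrm{sym}}(V)$ let $\mathcal T_rF(v_1,\dots,v_{r+2})=\frac1{(r+2)!}\sum_{\pi\in\mathfrak S_{r+2}}F(v_{\pi(1)},v_{\pi(2)})$; $C_r(V)_{\mathrm c}=\{F\in C_{\mathrm{sym}}(V):\mathcal T_rF\ge0\}$, and $C_r(V)_{\mathrm c}^*\subseteq M_{\mathrm{sym}}(V)$ is its dual cone. For a convex cone $\mathcal C\subseteq M_{\mathrm{sym}}(V)$, $\vartheta(G,\mathcal C)$ is the supremum of $\alpha(V^2)$ over $\alpha\in\mathcal C$ whose restriction to $E$ is zero and with $\alpha(\Delta)=1$, where $\Delta$ is the diagonal of $V^2$. *)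

(* Defs.v *)
From HB Require Import structures.
From mathcomp Require Import all_boot all_order all_algebra all_fingroup finmap.
From mathcomp Require Import all_classical all_reals all_analysis.

Set Implicit Arguments.
Unset Strict Implicit.
Unset Printing Implicit Defensive.

Import Order.TTheory GRing.Theory Num.Theory.
Import numFieldNormedType.Exports.

Local Open Scope classical_set_scope.
Local Open Scope card_scope.
Local Open Scope ring_scope.

(* The edge relation is the symmetric irreflexive set of ordered pairs (x, y)
   with xy an edge. *)
Definition clique (V : Type) (E : set (V * V)) (A : set V) : Prop :=
  forall x y, A x -> A y -> x <> y -> E (x, y).

Definition independent (V : Type) (E : set (V * V)) (A : set V) : Prop :=
  forall x y, A x -> A y -> ~ E (x, y).

Record packing_graph (V : topologicalType) (E : set (V * V)) : Prop := {
  edge_sym : forall x y, E (x, y) -> E (y, x) ;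
  edge_irr : forall x, ~ E (x, x) ;
  vertex_hausdorff : hausdorff_space V ;
  open_clique : forall A, finite_set A -> clique E A ->
    exists2 U, open U /\ clique E U & A `<=` U }.

(* The junk value 0 is taken only if there is no maximum, which cannot happen
   for a packing graph on a compact space. *)
Definition indep_number (V : Type) (E : set (V * V)) : nat :=
  xget 0%N [set n | (exists2 A, independent E A & A #= `I_n) /\
                    (forall A, independent E A -> A #<= `I_n)].

Definition metrizable (R : realType) (V : topologicalType) : Prop :=
  exists d : V -> V -> R,
    [/\ forall x y, d x y = 0 <-> x = y,
        forall x y, d x y = d y x,
        forall x y z, d x z <= d x y + d y z &
        forall x, nbhs x = filter_from [set e : R | 0 < e]
                                       (fun e => [set y | d x y < e])].

Definition Sub (V : choiceType) (r : nat) : Type :=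
  {S : {fset V} | (#|` S| <= r)%N}.

HB.instance Definition _ (V : choiceType) (r : nat) := Choice.on (Sub V r).

Lemma card_fset_of (V : choiceType) (r : nat) (v : 'I_r -> V) :
  (#|` [fset v i | i in 'I_r]%fset| <= r)%N.
Proof.
by apply: leq_trans (leq_imfset_card _ _ _) _; rewrite /= size_enum_ord.
Qed.

Definition sub_of (V : choiceType) (r : nat) (v : 'I_r -> V) : Sub V r :=
  exist _ [fset v i | i in 'I_r]%fset (card_fset_of v).

(* A set of subsets is open when its preimage under
   (v_1, ..., v_r) |-> {v_1, ..., v_r} is open in V^r.  For r > 0 this map has
   image Sub_r(V) \ {set0}, so this is the quotient topology there together
   with set0 as an isolated point; Sub_0(V) is the one-point space. *)
Definition Sub_open (V : topologicalType) (r : nat) : set_system (Sub V r) :=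
  [set U | open ((fun v : {ptws 'I_r -> V} => sub_of v) @^-1` U)].

Lemma Sub_openT (V : topologicalType) (r : nat) : @Sub_open V r setT.
Proof. by rewrite /Sub_open /= preimage_setT; exact: openT. Qed.

Lemma Sub_openI (V : topologicalType) (r : nat) : setI_closed (@Sub_open V r).
Proof. by move=> A B oA oB; rewrite /Sub_open /= preimage_setI; exact: openI. Qed.

Lemma Sub_open_bigU (V : topologicalType) (r : nat) (I : Type)
    (f : I -> set (Sub V r)) :
  (forall i, Sub_open (f i)) -> Sub_open (\bigcup_i f i).
Proof.
move=> of_; rewrite /Sub_open /= preimage_bigcup.
by apply: bigcup_open => i _; exact: of_.
Qed.

HB.instance Definition _ (V : topologicalType) (r : nat) :=
  isOpenTopological.Build (Sub V r)
    (@Sub_openT V r) (@Sub_openI V r) (@Sub_open_bigU V r).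

Definition Ind (V : topologicalType) (E : set (V * V)) (r : nat) : Type :=
  set_type [set S : Sub V r | independent E [set` val S]].

HB.instance Definition _ (V : topologicalType) (E : set (V * V)) (r : nat) :=
  Topological.on (Ind E r).

Definition Sub0 (V : choiceType) (r : nat) : Sub V r :=
  exist (fun S : {fset V} => (#|` S| <= r)%N) fset0 (leq0n r).

Lemma Sub0_independent (V : topologicalType) (E : set (V * V)) (r : nat) :
  Sub0 V r \in [set S : Sub V r | independent E [set` val S]].
Proof. by apply: mem_set => /= x y /=; rewrite in_fset0. Qed.

Definition Ind0 (V : topologicalType) (E : set (V * V)) (r : nat) : Ind E r :=
  exist _ (Sub0 V r) (Sub0_independent E r).

HB.instance Definition _ (V : topologicalType) (E : set (V * V)) (r : nat) :=
  isPointed.Build (Ind E r) (Ind0 E r).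

Definition elts (V : topologicalType) (E : set (V * V)) (r : nat)
  (I : Ind E r) : {fset V} := val (val I).

HB.instance Definition _ (X Y : ptopologicalType) := Pointed.on (X * Y)%type.

Definition borel (X : ptopologicalType) := g_sigma_algebraType (@open X).

Section radon.
Context {R : realType} {X : ptopologicalType}.
Variable nu : {charge set (borel X) -> \bar R}.

(* The constructions below do not depend on the choice of Hahn decomposition
   (Hahn_decomposition_uniq). *)
Definition hahn_pos : set (borel X) := projT1 (cid (Hahn_decomposition nu)).

Definition hahn_neg : set (borel X) :=
  projT1 (cid (projT2 (cid (Hahn_decomposition nu)))).

Definition hahn_posneg : hahn_decomposition nu hahn_pos hahn_neg :=
  projT2 (cid (projT2 (cid (Hahn_decomposition nu)))).

Definition total_variation (A : set (borel X)) : \bar R :=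
  charge_variation hahn_posneg A.

Definition radon : Prop :=
  forall (A : set (borel X)) (e : R), measurable A -> 0 < e ->
    exists K U : set X,
      [/\ compact K, open U, K `<=` A, A `<=` U &
          (total_variation (U `\` K) < e%:E)%E].

Definition nonneg_charge : Prop :=
  forall A : set (borel X), measurable A -> (0 <= nu A)%E.

Definition pairing (f : X -> R) : R :=
  \int[jordan_pos hahn_posneg]_x f x - \int[jordan_neg hahn_posneg]_x f x.

End radon.

Definition psd (R : realType) (X : Type) (F : X -> X -> R) : Prop :=
  forall (n : nat) (x : 'I_n -> X) (c : 'I_n -> R),
    0 <= \sum_(i < n) \sum_(j < n) c i * c j * F (x i) (x j).

Definition swap (X : Type) (p : X * X) : X * X := (p.2, p.1).

Definition swap3 (X Y : Type) (p : X * X * Y) : X * X * Y := (swap p.1, p.2).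

Section cones.
Context {R : realType}.

Definition Csym (X : ptopologicalType) : set (X * X -> R) :=
  [set F | continuous F /\ F \o @swap X = F].

Definition Csym_psd (X : ptopologicalType) : set (X * X -> R) :=
  [set F | @Csym X F /\ psd (fun x y => F (x, y))].

Definition Msym (X : ptopologicalType) :
    set ({charge set (borel (X * X)%type) -> \bar R}) :=
  [set mu | radon mu /\
    forall A : set (borel (X * X)%type), measurable A ->
      mu (@swap X @^-1` A) = mu A].

Definition Msym_dual (X : ptopologicalType) (C : set (X * X -> R)) :
    set ({charge set (borel (X * X)%type) -> \bar R}) :=
  [set mu | @Msym X mu /\ forall F, C F -> 0 <= pairing mu F].

Definition Csym3 (X Y : ptopologicalType) : set (X * X * Y -> R) :=
  [set F | continuous F /\ F \o @swap3 X Y = F].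

Definition Csym3_psd (X Y : ptopologicalType) : set (X * X * Y -> R) :=
  [set F | @Csym3 X Y F /\ forall q, psd (fun x y => F (x, y, q))].

Definition Msym3 (X Y : ptopologicalType) :
    set ({charge set (borel (X * X * Y)%type) -> \bar R}) :=
  [set mu | radon mu /\
    forall A : set (borel (X * X * Y)%type), measurable A ->
      mu (@swap3 X Y @^-1` A) = mu A].

Definition Msym3_dual (X Y : ptopologicalType) (C : set (X * X * Y -> R)) :
    set ({charge set (borel (X * X * Y)%type) -> \bar R}) :=
  [set mu | @Msym3 X Y mu /\ forall F, C F -> 0 <= pairing mu F].

(* mu is the image of nu under the adjoint of the operator L, which is defined
   on the functions in C. *)
Definition is_adjoint (X Y : ptopologicalType) (C : set (X -> R))
    (L : (X -> R) -> Y -> R) (nu : {charge set (borel Y) -> \bar R})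
    (mu : {charge set (borel X) -> \bar R}) : Prop :=
  forall F, C F -> pairing mu F = pairing nu (L F).

End cones.
Arguments Csym {R} X.
Arguments Csym_psd {R} X.
Arguments Msym {R} X.
Arguments Csym3 {R} X Y.
Arguments Csym3_psd {R} X Y.
Arguments Msym3 {R} X Y.

Section hierarchies.
Context {R : realType} {V : ptopologicalType}.
Variable E : set (V * V).

(* The index sets of the sums in opA and opB are finite, since J, J' and Q are
   subsets of I. *)
Definition opA (r : nat) (F : Ind E r * Ind E r -> R) (I : Ind E (2 * r)) : R :=
  \sum_(p \in [set p : Ind E r * Ind E r |
                 (elts p.1 `|` elts p.2)%fset = elts I]) F p.

Definition opB (r : nat) (F : Ind E 1 * Ind E 1 * Ind E (r - 2) -> R)
    (I : Ind E r) : R :=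
  \sum_(t \in [set t : Ind E 1 * Ind E 1 * Ind E (r - 2) |
                 (elts t.2 `|` elts t.1.1 `|` elts t.1.2)%fset = elts I]) F t.

Definition ind_eq (s k : nat) : set (borel (Ind E s)) :=
  [set I : Ind E s | #|` elts I| = k].

Definition moment_feasible (r : nat) :
    set ({charge set (borel (Ind E (2 * r))) -> \bar R}) :=
  [set nu | [/\ radon nu, nonneg_charge nu, nu [set Ind0 E (2 * r)] = 1%E &
    exists2 mu, Msym_dual (Csym_psd (Ind E r)) mu &
      is_adjoint (Csym (Ind E r)) (@opA r) nu mu]].

Definition moment (r : nat) : \bar R :=
  ereal_sup [set nu (ind_eq 1) | nu in @moment_feasible r].

(* Meaningful for r >= 2 only, since r - 2 is truncated. *)
Definition block_feasible (r : nat) :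
    set ({charge set (borel (Ind E r)) -> \bar R}) :=
  [set nu | [/\ radon nu, nonneg_charge nu, nu [set Ind0 E r] = 1%E &
    exists2 mu, Msym3_dual (Csym3_psd (Ind E 1) (Ind E (r - 2))) mu &
      is_adjoint (Csym3 (Ind E 1) (Ind E (r - 2))) (@opB r) nu mu]].

Definition block_moment (r : nat) : \bar R :=
  ereal_sup [set nu (ind_eq 1) | nu in @block_feasible r].

Definition opT (r : nat) (F : V * V -> R) (v : 'I_r.+2 -> V) : R :=
  (r.+2)`!%:R^-1 *
  \sum_(s : 'S_r.+2) F (v (s ord0), v (s (lift ord0 ord0))).

Definition Ccop (r : nat) : set (V * V -> R) :=
  [set F | Csym V F /\ forall v, 0 <= @opT r F v].

(* The base point of V makes the vertex set nonempty; otherwise no measure would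
   have mass 1 on the diagonal and the supremum would be -oo. *)
Definition theta (C : set ({charge set (borel (V * V)%type) -> \bar R})) :
    \bar R :=
  ereal_sup [set a setT | a in
    [set a | [/\ C a,
      forall A : set (borel (V * V)%type), measurable A -> A `<=` E -> a A = 0%E &
      a [set p : V * V | p.1 = p.2] = 1%E]]].

End hierarchies.
Arguments moment R {V} E r.
Arguments block_moment R {V} E r.
Arguments Ccop R V r : clear implicits.

(* Main.v *)
Require Import Defs.
From HB Require Import structures.
From mathcomp Require Import all_boot all_order all_algebra all_fingroup finmap.
From mathcomp Require Import all_classical all_reals all_analysis.
From mathcomp Require Import measurable_realfun ring zify.

Set Implicit Arguments.
Unset Strict Implicit.
Unset Printing Implicit Defensive.

Local Open Scope classical_set_scope.
Local Open Scope ring_scope.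

Import Order.TTheory GRing.Theory Num.Theory.
Import numFieldNormedType.Exports.

(** Write [a] for the independence number.  Everything follows from four bounds:

    - [moment k <= block_moment n] if [n - 2 < k] ([moment_le_block]);
    - [block_moment n <= a] if [a < n] ([block_moment_le_indep]);
    - [a <= moment k] if [0 < k] ([indep_le_moment]);
    - [a <= theta] ([theta_ge_indep]), and [theta = +oo] if [r + 2 <= a]
      ([theta_pinfty]).

    The first gives the left inequality.  For the right one, either
    [r + 2 <= a] and theta is infinite, or [a <= r + 1] and
    [block_moment (r + 2) <= a <= theta].  For [a + 2 <= r] the first three
    bounds close into a cycle, so that all the quantities are equal.

    Bounding theta from below needs feasible measures only.  The uniform measure
    on the ordered pairs of points of a maximum independent set gives [a]: it is
    positive on [C_r] because sampling [r + 2] points independently averages [T_r].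
    If there are [r + 2] independent points, [T_r] at these points only sees
    off-diagonal pairs, so that any multiple of the corresponding measure may be
    added to a point mass on the diagonal.

    The bound on the block hierarchy at large order comes from the kernels
    [1_{|Q| = q} f(J) f(J')] with [f(set0) = - a] and [f({x}) = 1].  Their images
    under [B_n] depend on [|I|] only and are supported on [|I| = q, q + 1, q + 2]
    ([opB_certificate]).  Testing a feasible [nu] on them gives linear
    inequalities between the masses [N_k] of the sets of size [k], and these imply
    [(q + 1) N_{q + 1} <= (a - q) N_q] for [q = a, a - 1, ..., 0] in turn, starting
    from [N_{a + 1} = 0].  The case [q = 0] is [N_1 <= a].

    For the comparison of the two hierarchies a feasible [nu] is restricted to
    the independent sets of size at most [n].  The image of the restricted
    measure under the adjoint of [B_n] is constructed explicitly
    ([exists_block_adjoint]): decompositions of an independent set form finitely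
    many sheets, each the graph of a continuous map on a Borel piece.  Its
    positivity on a kernel [F] is tested by lifting [F] to a positive semidefinite
    kernel [G] on pairs of sets of size at most [k] such that [A_k G] is uniformly
    close to [B_n F] ([exists_psd_lift]).

    All of this rests on the local structure of the spaces of independent sets:
    near an independent tuple, independent tuples repeat their entries in the
    same way ([near_pattern]).  Hence the sums over decompositions are locally
    finite sums with a fixed index set, and are continuous
    ([continuous_fiber2_sum]). *)

(** * Finite independent sets *)

Section pts.
Context {V : choiceType}.

Definition pts (L : finType) (s : L -> V) (T : {set L}) : {fset V} :=
  [fset s l | l in T]%fset.

Lemma in_ptsP (L : finType) (s : L -> V) (T : {set L}) (x : V) :
  reflect (exists2 l, l \in T & x = s l) (x \in pts s T).
Proof. exact: imfsetP. Qed.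

Lemma mem_pts (L : finType) (s : L -> V) (T : {set L}) l :
  l \in T -> s l \in pts s T.
Proof. by move=> lT; apply/in_ptsP; exists l. Qed.

Lemma pts0 (L : finType) (s : L -> V) : pts s finset.set0 = fset0.
Proof.
by apply/fsetP => x; rewrite in_fset0; apply/in_ptsP => -[l]; rewrite finset.inE.
Qed.

Lemma leq_card_pts (L : finType) (s : L -> V) (T : {set L}) :
  (#|` pts s T| <= #|T|)%N.
Proof. by rewrite /pts; apply: leq_trans (leq_imfset_card _ _ _) _; rewrite /= -cardE. Qed.

Lemma card_pts (L : finType) (s : L -> V) (T A : {set L}) :
  {in T &, injective s} -> A \subset T -> #|` pts s A| = #|A|.
Proof.
move=> sI AT; rewrite /pts card_in_imfset ?cardE//= => x y xA yA.
by apply: sI; apply: (fintype.subsetP AT).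
Qed.

(** A transversal of the fibres of [v], which serves every tuple with the same
    equalities between entries as [v]. *)
Lemma exists_reps (L : finType) (v : L -> V) :
  exists R : {set L}, forall w : L -> V,
    (forall i j, (w i == w j) = (v i == v j)) ->
    {in R &, injective w} /\ pts w finset.setT = pts w R.
Proof.
pose r i := odflt i [pick j | v j == v i].
have rP i : v (r i) = v i by rewrite /r; case: pickP => [j /eqP|].
exists [set r i | i : L]%SET => w wv; split.
  move=> _ _ /finset.imsetP[i _ ->] /finset.imsetP[j _ ->] /eqP.
  rewrite wv !rP => /eqP vij.
  rewrite /r (eq_pick (Q := fun k => v k == v j)); last by move=> k; rewrite vij.
  by case: pickP => // /(_ j); rewrite eqxx.
have wr i : w (r i) = w i by apply/eqP; rewrite wv rP.
apply/fsetP => x; apply/in_ptsP/in_ptsP => -[i iR ->].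
  by exists (r i); rewrite ?wr//; apply/finset.imsetP; exists i.
by exists i; rewrite ?finset.inE.
Qed.

End pts.

Section ind_algebra.
Context {V : topologicalType} {E : set (V * V)}.

Lemma elts_indep n (I : Ind E n) : independent E [set` elts I].
Proof. by have := set_mem (valP I). Qed.

Lemma card_elts n (I : Ind E n) : (#|` elts I| <= n)%N.
Proof. exact: valP (val I). Qed.

Lemma elts_inj n : injective (@elts V E n).
Proof. by move=> I J IJ; apply/val_inj/val_inj. Qed.

Definition is_ind n (A : {fset V}) : Prop :=
  (#|` A| <= n)%N /\ independent E [set` A].

(** A total function, with junk value [Ind0], so that sums over index subsets can
    be written without a dependent domain. *)
Definition mkInd n (A : {fset V}) : Ind E n :=
  match pselect (is_ind n A) with
  | left p => exist _ (exist _ A p.1) (mem_set p.2)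
  | right _ => Ind0 E n
  end.

Lemma elts_mkInd n (A : {fset V}) : is_ind n A -> elts (mkInd n A) = A.
Proof. by rewrite /mkInd; case: pselect. Qed.

Lemma is_ind_elts n (I : Ind E n) : is_ind n (elts I).
Proof. by split; [exact: card_elts | exact: elts_indep]. Qed.

Lemma mkInd_elts n (I : Ind E n) : mkInd n (elts I) = I.
Proof. by apply: elts_inj; rewrite elts_mkInd//; exact: is_ind_elts. Qed.

Lemma mkInd0 n : mkInd n fset0 = Ind0 E n.
Proof.
by apply: elts_inj; rewrite elts_mkInd//; split => // x y /=; rewrite in_fset0.
Qed.

Definition indep_tuple (L : Type) (w : L -> V) : Prop :=
  forall i j, ~ E (w i, w j).

Definition indt n (w : 'I_n -> V) : Ind E n := mkInd n (pts w finset.setT).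

Lemma is_ind_pts (L : finType) n (w : L -> V) (A : {set L}) :
  indep_tuple w -> (#|A| <= n)%N -> is_ind n (pts w A).
Proof.
move=> wi An; split; first exact: leq_trans (leq_card_pts _ _) An.
by move=> x y /= /in_ptsP[i _ ->] /in_ptsP[j _ ->]; exact: wi.
Qed.

Lemma elts_indt n (w : 'I_n -> V) :
  indep_tuple w -> elts (indt w) = pts w finset.setT.
Proof. by move=> wi; rewrite elts_mkInd//; apply: is_ind_pts; rewrite// cardsT card_ord. Qed.

Lemma sub_of_pts n (w : 'I_n -> V) : val (sub_of w) = pts w finset.setT.
Proof.
apply/fsetP => x; apply/idP/idP => /imfsetP[l _ ->]; apply/imfsetP; exists l => //=.
Qed.

Lemma exists_indt n (I : Ind E n) : elts I != fset0 ->
  exists2 v : 'I_n -> V, indep_tuple v & I = indt v.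
Proof.
move=> /fset0Pn[x xI].
pose v (i : 'I_n) := nth x (elts I) i.
have vI i : v i \in elts I.
  rewrite /v; have [lt|ge] := ltnP i (size (elts I)); first exact: mem_nth.
  by rewrite nth_default.
have vi : indep_tuple v by move=> i j; apply: (elts_indep (vI i) (vI j)).
exists v => //; apply: elts_inj; rewrite elts_indt//.
apply/fsetP => y; apply/idP/in_ptsP => [yI|[i _ ->]//].
have ly : (index y (elts I) < n)%N.
  by apply: leq_trans (card_elts I); rewrite index_mem.
by exists (Ordinal ly); rewrite ?finset.inE// /v /= nth_index.
Qed.

End ind_algebra.
Arguments mkInd {V} E n A.
Arguments indep_tuple {V} E {L} w.
Arguments indt {V} E {n} w.

(** * The topology of the spaces of independent sets *)

Instance ptws_filter (T : topologicalType) (L : finType) (v : {ptws L -> T}) :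
  Filter (nbhs v).
Proof. exact: nbhs_filter. Qed.

(** A tuple bound by a [\near] notation and then used as a plain function gets
    the type [L -> T], at which instance resolution looks for this filter. *)
Instance ptws_filter_fun (T : topologicalType) (L : finType)
    (v : {ptws L -> T}) : @Filter (L -> T) (nbhs v).
Proof. exact: (ptws_filter v). Qed.

Lemma near_coord (T : topologicalType) (L : finType) (v : {ptws L -> T})
    (P : L -> T -> Prop) :
  (forall i, \forall y \near v i, P i y) ->
  \forall w \near v, forall i, P i (w i).
Proof.
move=> Pn.
apply: (@filter_forall _ L (fun i (w : {ptws L -> T}) => P i (w i)) (nbhs v)) => i.
exact: (@proj_continuous _ _ i v _ (Pn i)).
Qed.

Lemma ptws_comp_continuous (T : topologicalType) (L M : finType) (e : M -> L) :
  continuous ((fun w => w \o e) : {ptws L -> T} -> {ptws M -> T}).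
Proof.
move=> v; apply/cvg_sup => i; apply/cvg_image.
  by apply/seteqP; split => // y _; exists (fun=> y).
move=> A /=; rewrite nbhsE /= => -[B [Bo Bv] BA].
exists [set f : M -> T | A (f i)].
  have : nbhs (v (e i)) A by rewrite nbhsE; exists B.
  exact: (@proj_continuous _ _ (e i) v).
apply/seteqP; split => [x/= [f Af <-]//|x Ax]; exists (fun=> x) => //.
Qed.

Section ind_topology.
Context {V : topologicalType} {E : set (V * V)}.
Hypothesis packE : packing_graph E.

Lemma vertex_open_clique (x : V) : exists2 U : set V, nbhs x U & clique E U.
Proof.
have [|U [oU cU] xU] := open_clique packE (finite_set1 x).
  by move=> ? ? /= -> ->.
by exists U => //; apply: open_nbhs_nbhs; split => //; exact: xU.
Qed.

(** An edge is a clique, so it lies in an open clique [U]; [x] and [y] have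
    disjoint neighbourhoods inside [U], and those are completely joined. *)
Lemma near_edge (x y : V) : E (x, y) ->
  exists2 U : set V, nbhs x U & exists2 W : set V, nbhs y W & forall a b, U a -> W b -> E (a, b).
Proof.
move=> Exy; have xy : x <> y by move=> xy; move: Exy; rewrite xy; exact: edge_irr.
have [||U [oU cU] xU] := open_clique packE (A := [set x; y]).
- by rewrite finite_setU; split; exact: finite_set1.
- move=> a b /= [->|->] [->|->]// _; exact: (edge_sym packE).
have := vertex_hausdorff packE; rewrite open_hausdorff => /(_ x y).
case; first exact/eqP.
move=> [A B] /= [/set_mem xA /set_mem yB] [oA oB /eqP AB].
exists (U `&` A); first by apply: open_nbhs_nbhs; split; [exact: openI|split=> //; apply: xU; left].
exists (U `&` B); first by apply: open_nbhs_nbhs; split; [exact: openI|split=> //; apply: xU; right].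
move=> a b [Ua Aa] [Ub Bb]; apply: cU => // ab; rewrite -[False]/(set0 b) -AB.
by split => //; rewrite -ab.
Qed.

Lemma near_not_indep (L : finType) (v : {ptws L -> V}) : ~ indep_tuple E v ->
  \forall w \near v, ~ indep_tuple E w.
Proof.
move=> /existsNP[i] /existsNP[j] /contrapT /near_edge[U vU [W vW UW]].
have Ui := @proj_continuous _ _ i v _ vU.
have Wj := @proj_continuous _ _ j v _ vW.
apply: (@filterS2 _ (nbhs v) _ _ _ _ _ Ui Wj) => w /= Uw Ww /(_ i j); apply.
exact: UW.
Qed.

(** Two points of an independent set cannot lie in a common clique, so points
    of a tuple that are equal stay equal under small independent perturbations;
    points that are distinct stay distinct by separation. *)
Lemma near_pattern (L : finType) (v : {ptws L -> V}) :
  \forall w \near v, indep_tuple E w ->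
    forall i j, (w i == w j) = (v i == v j).
Proof.
suff H (ij : L * L) : \forall w \near v, indep_tuple E w ->
    (w ij.1 == w ij.2) = (v ij.1 == v ij.2).
  apply: (@filterS _ (nbhs v) _ _ _ _ (@filter_forall _ _
    (fun ij (w : L -> V) => indep_tuple E w ->
      (w ij.1 == w ij.2) = (v ij.1 == v ij.2)) (nbhs v) _ H)).
  by move=> w wH wi i j; exact: (wH (i, j)).
case: ij => i j /=; have [vij|vij] := eqVneq (v i) (v j).
  have [U vU cU] := vertex_open_clique (v i).
  have vU' : nbhs (v j) U by rewrite -vij.
  have Ui := @proj_continuous _ _ i v _ vU.
  have Uj := @proj_continuous _ _ j v _ vU'.
  apply: (@filterS2 _ (nbhs v) _ _ _ _ _ Ui Uj) => w /= Uwi Uwj wi.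
  by apply/eqP; apply: contrapT => wij; apply: (wi i j); apply: cU.
have := vertex_hausdorff packE; rewrite open_hausdorff => /(_ _ _ vij).
move=> [[A B] /= [/set_mem xA /set_mem yB] [oA oB /eqP AB]].
have Ai := @proj_continuous _ _ i v _ (open_nbhs_nbhs (conj oA xA)).
have Bj := @proj_continuous _ _ j v _ (open_nbhs_nbhs (conj oB yB)).
apply: (@filterS2 _ (nbhs v) _ _ _ _ _ Ai Bj) => w /= Awi Bwj wi.
apply/negbTE/eqP => wij; rewrite -[False]/(set0 (w i)) -AB; by split; rewrite // wij.
Qed.

(** The independent tuples form a closed saturated subset of [V^n], so openness
    in [Ind E n] can be tested along independent tuples; the empty set needs no
    test when [0 < n], and is the image of the empty tuple when [n = 0]. *)
Lemma open_Ind n (U : set (Ind E n)) :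
  (forall v : {ptws 'I_n -> V}, indep_tuple E v -> U (indt E v) ->
    \forall w \near v, indep_tuple E w -> U (indt E w)) -> open U.
Proof.
move=> HU; exists [set S | forall I : Ind E n, val I = S -> U I]; last first.
  by apply/seteqP; split => [I /(_ I erefl)//|I UI J /= /val_inj ->].
have indtE (v : 'I_n -> V) (I : Ind E n) : val I = sub_of v -> indep_tuple E v /\ I = indt E v.
  move=> Iv; have eI : elts I = pts v finset.setT by rewrite -sub_of_pts -Iv.
  suff vi : indep_tuple E v by split => //; apply: elts_inj; rewrite elts_indt.
  by move=> i j; apply: (@elts_indep _ _ _ I); rewrite /= eI; apply: mem_pts; rewrite finset.inE.
rewrite /open /= /Sub_open /= openE => v /= Hv; rewrite /interior; have [vi|vi] := pselect (indep_tuple E v); last first.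
  apply: filterS (near_not_indep vi) => w wi I /indtE[] //.
have Uv : U (indt E v).
  by apply: Hv; apply: val_inj; rewrite -[LHS]/(elts (indt E v)) elts_indt// sub_of_pts.
by apply: filterS (HU v vi Uv) => w wU I /indtE[/wU + ->].
Qed.

(** Selecting the entries with index in [a] is made continuous by selecting them,
    with repetitions, along a map [e] from ['I_k]; the empty selection has no
    such map but is constant. *)
Lemma near_mkInd n k (a : {set 'I_n}) (v : {ptws 'I_n -> V}) (U : set (Ind E k)) :
  indep_tuple E v -> (#|a| <= k)%N -> nbhs (mkInd E k (pts v a)) U ->
  \forall w \near v, indep_tuple E w -> U (mkInd E k (pts w a)).
Proof.
move=> vi ak; rewrite nbhsE => -[_ [[W oW <-] Wv] WU].
have [a0|[x xa]] := set_0Vmem a.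
  near=> w => _; apply: WU; move: Wv; rewrite /= a0.
  by rewrite !pts0.
pose e (i : 'I_k) := nth x (enum a) i.
have ea (w : 'I_n -> V) : pts (w \o e) finset.setT = pts w a.
  apply/fsetP => y; apply/in_ptsP/in_ptsP => [[i _ ->]|[l la ->]].
    exists (e i) => //; rewrite /e.
    have [lt|ge] := ltnP i (size (enum a)); last by rewrite nth_default.
    by rewrite -mem_enum mem_nth.
  have li : (index l (enum a) < k)%N.
    by apply: leq_trans ak; rewrite cardE index_mem mem_enum.
  by exists (Ordinal li); rewrite ?finset.inE// /e /= nth_index// mem_enum.
have vE (w : 'I_n -> V) : indep_tuple E w -> val (mkInd E k (pts w a)) = sub_of (w \o e) :> Defs.Sub V k.
  move=> wi; apply: val_inj; rewrite sub_of_pts ea.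
  by apply: elts_mkInd; exact: is_ind_pts.
have : nbhs (v \o e : {ptws 'I_k -> V}) ((fun u : {ptws 'I_k -> V} => sub_of u) @^-1` W).
  by apply: open_nbhs_nbhs; split; [exact: oW | rewrite /= -vE].
move=> /(@ptws_comp_continuous _ _ _ e v) Hn; apply: (@filterS _ (nbhs v) _ _ _ _ Hn) => w /= Ww wi.
by apply: WU; rewrite /= -(vE w wi) in Ww.
Unshelve. all: by end_near. Qed.

Lemma continuous_Ind n (Z : topologicalType) (f : Ind E n -> Z) :
  (forall (v : {ptws 'I_n -> V}), indep_tuple E v -> forall U, nbhs (f (indt E v)) U ->
    \forall w \near v, indep_tuple E w -> U (f (indt E w))) ->
  continuous f.
Proof.
move=> Hf; apply/continuousP => O oO; apply: open_Ind => v vi Ofv.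
by apply: Hf => //; apply: open_nbhs_nbhs.
Qed.

Lemma near_card n (v : {ptws 'I_n -> V}) : indep_tuple E v ->
  \forall w \near v, indep_tuple E w ->
    #|` elts (indt E w)| = #|` elts (indt E v)|.
Proof.
move=> vi; have [R RP] := exists_reps v.
apply: filterS (near_pattern v) => w wv wi; have {}wv := wv wi.
have [wI wR] := RP w wv; have [vI vR] := RP v (fun _ _ => erefl).
by rewrite !elts_indt// wR vR !(card_pts (T := R)).
Qed.

End ind_topology.

(** * Sums over the decompositions of an independent set *)

Section subset_parametrization.
Context {V : choiceType} {L : finType} (s : L -> V) (T : {set L}).
Hypothesis sI : {in T &, injective s}.
Implicit Types A B : {set L}.

Lemma mem_pts_inj A l : A \subset T -> l \in T -> (s l \in pts s A) = (l \in A).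
Proof.
move=> AT lT; apply/in_ptsP/idP => [[k kA /sI lk]|lA]; last by exists l.
by rewrite lk// (fintype.subsetP AT).
Qed.

Lemma pts_inj A B : A \subset T -> B \subset T -> pts s A = pts s B -> A = B.
Proof.
move=> AT BT AB; apply/finset.setP => l; apply/idP/idP => lA.
  have lT := fintype.subsetP AT _ lA.
  by rewrite -(mem_pts_inj BT lT) -AB mem_pts.
have lT := fintype.subsetP BT _ lA.
by rewrite -(mem_pts_inj AT lT) AB mem_pts.
Qed.

Lemma ptsU A B : pts s (A :|: B)%SET = (pts s A `|` pts s B)%fset.
Proof.
apply/fsetP => x; rewrite in_fsetU; apply/in_ptsP/orP.
  by case=> l; rewrite finset.in_setU => /orP[lA|lB] ->; [left|right]; exact: mem_pts.
by case=> /in_ptsP[l lA ->]; exists l => //; rewrite finset.in_setU lA ?orbT.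
Qed.

Lemma sub_pts (J : {fset V}) : (J `<=` pts s T)%fset ->
  exists2 A : {set L}, A \subset T & J = pts s A.
Proof.
move=> JT; exists [set l in T | s l \in J]%SET.
  by apply/fintype.subsetP => l; rewrite finset.inE => /andP[].
apply/fsetP => x; apply/idP/in_ptsP => [xJ|[l + ->]]; last first.
  by rewrite finset.inE => /andP[].
have /in_ptsP[l lT xl] := fsubsetP JT _ xJ.
by exists l => //; rewrite finset.inE lT -xl.
Qed.

End subset_parametrization.

Lemma fsbig_fin (R : nmodType) (T : finType) (P : pred T) (F : T -> R) :
  \sum_(i \in [set i | P i]) F i = \sum_(i | P i) F i.
Proof.
rewrite (fsbigE (enum P)) ?enum_uniq//.
- rewrite big_enum_cond; apply: eq_bigl => i.
  have -> : (i \in [set i | P i]) = P i by apply/idP/idP => [/set_mem|/mem_set].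
  by rewrite unfold_in andbb.
- by move=> i /=; rewrite mem_enum.
- by move=> i /= Pi; rewrite mem_enum unfold_in Pi.
Qed.

Section fiber_sums.
Context {R : realType} {V : topologicalType} {E : set (V * V)}.
Hypothesis packE : packing_graph E.

Definition fiber2 a b (I : {fset V}) : set (Ind E a * Ind E b) :=
  [set p | (elts p.1 `|` elts p.2)%fset = I].

Definition fiber3 a b c (I : {fset V}) : set (Ind E a * Ind E b * Ind E c) :=
  [set t | (elts t.2 `|` elts t.1.1 `|` elts t.1.2)%fset = I].

Definition cover2 a b (L : finType) (T : {set L}) : pred ({set L} * {set L}) :=
  fun p => [&& #|p.1| <= a, #|p.2| <= b & p.1 :|: p.2 == T]%N%SET.

Definition cover3 a b c (L : finType) (T : {set L}) :
    pred ({set L} * {set L} * {set L}) :=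
  fun t => [&& #|t.1.1| <= a, #|t.1.2| <= b, #|t.2| <= c
             & t.2 :|: t.1.1 :|: t.1.2 == T]%N%SET.

Section one_fiber.
Context {L : finType} (s : L -> V) (T : {set L}) (n : nat) (I : Ind E n).
Hypotheses (sI : {in T &, injective s}) (eI : elts I = pts s T).

Lemma elts_sub_mkInd k (A : {set L}) : A \subset T -> (#|A| <= k)%N ->
  elts (mkInd E k (pts s A)) = pts s A.
Proof.
move=> AT Ak; apply: elts_mkInd; split.
  exact: leq_trans (leq_card_pts _ _) Ak.
have sA x : x \in pts s A -> x \in elts I.
  move=> /in_ptsP[l lA ->]; rewrite eI; apply: mem_pts.
  exact: (fintype.subsetP AT).
by move=> x y /= /sA xI /sA yI; exact: (elts_indep xI yI).
Qed.

Lemma sub_elts_pts k (J : Ind E k) : (elts J `<=` elts I)%fset ->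
  exists A : {set L}, [/\ A \subset T, (#|A| <= k)%N, elts J = pts s A &
    J = mkInd E k (pts s A)].
Proof.
rewrite eI => /(sub_pts (s := s))[A AT JA]; exists A; split => //.
  by rewrite -(card_pts sI AT) -JA card_elts.
by rewrite -JA mkInd_elts.
Qed.

(** Subsets of [I] of size at most [k] correspond to subsets of [T] of size at
    most [k], which turns the sum over a fibre into a sum over a finite type
    that does not depend on [I]. *)
Lemma fiber2_sum a b (F : Ind E a * Ind E b -> R) :
  \sum_(p \in fiber2 (elts I)) F p =
  \sum_(p | cover2 a b T p) F (mkInd E a (pts s p.1), mkInd E b (pts s p.2)).
Proof.
rewrite -fsbig_fin; apply: reindex_fsbig; split.
- move=> [A B] /= /and3P[/= Aa Bb /eqP AB].
  have AT : A \subset T by rewrite -AB finset.subsetUl.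
  have BT : B \subset T by rewrite -AB finset.subsetUr.
  by rewrite /fiber2 /= !elts_sub_mkInd// -ptsU AB eI.
- move=> [A B] [A' B'] /set_mem/and3P[/= Aa Bb /eqP AB] /set_mem/and3P[/= Aa' Bb' /eqP AB'].
  have AT : A \subset T by rewrite -AB finset.subsetUl.
  have BT : B \subset T by rewrite -AB finset.subsetUr.
  have AT' : A' \subset T by rewrite -AB' finset.subsetUl.
  have BT' : B' \subset T by rewrite -AB' finset.subsetUr.
  move=> [] /(congr1 (@elts _ _ _)) + /(congr1 (@elts _ _ _)).
  by rewrite !elts_sub_mkInd// => /(pts_inj sI) -> // /(pts_inj sI) ->.
- move=> [J J'] /= JJ'.
  have [|A [AT Aa eA JA]] := @sub_elts_pts _ J.
    by rewrite -JJ' fsubsetUl.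
  have [|B [BT Bb eB JB]] := @sub_elts_pts _ J'.
    by rewrite -JJ' fsubsetUr.
  exists (A, B); last by rewrite /= -JA -JB.
  rewrite /= /cover2 /= Aa Bb /=; apply/eqP/(pts_inj sI) => //.
    by rewrite finset.subUset AT.
  by rewrite ptsU -eA -eB JJ' eI.
Qed.

Lemma fiber3_sum a b c (F : Ind E a * Ind E b * Ind E c -> R) :
  \sum_(t \in fiber3 (elts I)) F t =
  \sum_(t | cover3 a b c T t)
    F (mkInd E a (pts s t.1.1), mkInd E b (pts s t.1.2), mkInd E c (pts s t.2)).
Proof.
rewrite -fsbig_fin; apply: reindex_fsbig.
have subT (A B C : {set L}) : [/\ A \subset T, B \subset T & C \subset T] <-> (C :|: A :|: B)%SET \subset T.
  by rewrite !finset.subUset; split => [[-> -> ->]|/andP[/andP[-> ->] ->]].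
split.
- move=> [[A B] C] /= /and4P[/= Aa Bb Cc /eqP ABC].
  have [AT BT CT] : [/\ A \subset T, B \subset T & C \subset T] by apply/subT; rewrite ABC.
  by rewrite /fiber3 /= !elts_sub_mkInd// -!ptsU ABC eI.
- move=> [[A B] C] [[A' B'] C'] /set_mem/and4P[/= Aa Bb Cc /eqP ABC].
  move=> /set_mem/and4P[/= Aa' Bb' Cc' /eqP ABC'].
  have [AT BT CT] : [/\ A \subset T, B \subset T & C \subset T] by apply/subT; rewrite ABC.
  have [AT' BT' CT'] : [/\ A' \subset T, B' \subset T & C' \subset T] by apply/subT; rewrite ABC'.
  move=> [] /(congr1 (@elts _ _ _)) + /(congr1 (@elts _ _ _)) + /(congr1 (@elts _ _ _)).
  by rewrite !elts_sub_mkInd// => /(pts_inj sI) -> // /(pts_inj sI) -> // /(pts_inj sI) ->.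
- move=> [[J J'] Q] /= JJ'.
  have [|A [AT Aa eA JA]] := @sub_elts_pts _ J.
    by rewrite -JJ' fsubsetU// fsubsetUr.
  have [|B [BT Bb eB JB]] := @sub_elts_pts _ J'.
    by rewrite -JJ' fsubsetUr.
  have [|C [CT Cc eC JC]] := @sub_elts_pts _ Q.
    by rewrite -JJ' fsubsetU// fsubsetUl.
  exists (A, B, C); last by rewrite /= -JA -JB -JC.
  rewrite /= /cover3 /= Aa Bb Cc /=; apply/eqP/(pts_inj sI) => //.
    exact/subT.
  by rewrite !ptsU -eA -eB -eC JJ' eI.
Qed.

End one_fiber.

Definition indnbhs (L : finType) (v : {ptws L -> V}) : set_system (L -> V) :=
  within [set w | indep_tuple E w] (nbhs v).

Instance indnbhs_filter (L : finType) (v : {ptws L -> V}) : Filter (indnbhs v).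
Proof. exact: within_filter. Qed.

Lemma cvg_mkInd n k (a : {set 'I_n}) (v : {ptws 'I_n -> V}) :
  indep_tuple E v -> (#|a| <= k)%N ->
  (fun w => mkInd E k (pts w a)) @ indnbhs v --> mkInd E k (pts v a).
Proof. by move=> vi ak U /(near_mkInd vi ak). Qed.

Lemma cvg_mkInd2 n a b (A B : {set 'I_n}) (v : {ptws 'I_n -> V}) :
  indep_tuple E v -> (#|A| <= a)%N -> (#|B| <= b)%N ->
  (fun w => (mkInd E a (pts w A), mkInd E b (pts w B))) @ indnbhs v -->
  (mkInd E a (pts v A), mkInd E b (pts v B)).
Proof.
by move=> vi Aa Bb; exact: (cvg_pair (cvg_mkInd vi Aa) (cvg_mkInd vi Bb)).
Qed.

Lemma cvg_mkInd3 n a b c (A B C : {set 'I_n}) (v : {ptws 'I_n -> V}) :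
  indep_tuple E v -> (#|A| <= a)%N -> (#|B| <= b)%N -> (#|C| <= c)%N ->
  (fun w => (mkInd E a (pts w A), mkInd E b (pts w B), mkInd E c (pts w C)))
    @ indnbhs v -->
  (mkInd E a (pts v A), mkInd E b (pts v B), mkInd E c (pts v C)).
Proof.
move=> vi Aa Bb Cc.
exact: (cvg_pair (cvg_mkInd2 vi Aa Bb) (cvg_mkInd vi Cc)).
Qed.

(** Near an independent tuple [v] the sum runs over the covers of one fixed
    transversal of [v]; each term is continuous in the perturbed tuple. *)
Lemma continuous_fiber2_sum a b n (F : Ind E a * Ind E b -> R) :
  continuous F ->
  continuous (fun I : Ind E n => \sum_(p \in fiber2 (elts I)) F p).
Proof.
move=> cF; apply: continuous_Ind => // v vi U.
have [S SP] := exists_reps v.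
pose g (w : 'I_n -> V) := \sum_(p | cover2 a b S p)
  F (mkInd E a (pts w p.1), mkInd E b (pts w p.2)).
have gE (w : 'I_n -> V) : indep_tuple E w -> (forall i j, (w i == w j) = (v i == v j)) ->
    \sum_(p \in fiber2 (elts (indt E w))) F p = g w.
  move=> wi /SP[wI wS]; apply: fiber2_sum => //.
  by rewrite elts_indt.
rewrite gE// => Ug.
have cg : g @ indnbhs v --> g v.
  have addC : continuous (fun x : R * R => x.1 + x.2) by exact: add_continuous.
  apply: (cvg_big addC) => -[A B] /and3P[/= Aa Bb _].
  by apply: continuous_cvg; [exact: cF | exact: cvg_mkInd2].
have := cg _ Ug; apply: filterS2 (near_pattern packE v) => w /= wv gU wi.
by rewrite gE//; [exact: gU | exact: wv].
Qed.

Lemma continuous_fiber3_sum a b c n (F : Ind E a * Ind E b * Ind E c -> R) :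
  continuous F ->
  continuous (fun I : Ind E n => \sum_(t \in fiber3 (elts I)) F t).
Proof.
move=> cF; apply: continuous_Ind => // v vi U.
have [S SP] := exists_reps v.
pose g (w : 'I_n -> V) := \sum_(t | cover3 a b c S t)
  F (mkInd E a (pts w t.1.1), mkInd E b (pts w t.1.2), mkInd E c (pts w t.2)).
have gE (w : 'I_n -> V) : indep_tuple E w -> (forall i j, (w i == w j) = (v i == v j)) ->
    \sum_(t \in fiber3 (elts (indt E w))) F t = g w.
  move=> wi /SP[wI wS]; apply: fiber3_sum => //.
  by rewrite elts_indt.
rewrite gE// => Ug.
have cg : g @ indnbhs v --> g v.
  have addC : continuous (fun x : R * R => x.1 + x.2) by exact: add_continuous.
  apply: (cvg_big addC).
  move=> [[A B] C] /and4P[/= Aa Bb Cc _].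
  by apply: continuous_cvg; [exact: cF | exact: cvg_mkInd3].
have := cg _ Ug; apply: filterS2 (near_pattern packE v) => w /= wv gU wi.
by rewrite gE//; [exact: gU | exact: wv].
Qed.

End fiber_sums.

(** * Separation and compactness *)

Section ind_separation.
Context {V : topologicalType} {E : set (V * V)}.
Hypothesis packE : packing_graph E.

Lemma open_card n (P : nat -> Prop) : open [set I : Ind E n | P #|` elts I|].
Proof.
apply: (open_Ind packE) => v vi /= Pv.
by apply: filterS (near_card packE vi) => w wv wi; rewrite /= wv.
Qed.

Lemma open_meets n (U : set V) : open U ->
  open [set I : Ind E n | exists2 x, x \in elts I & U x].
Proof.
move=> oU; apply: (open_Ind packE) => v vi /=; rewrite elts_indt//.
move=> [_ /in_ptsP[i _ ->] Uvi].
have Un := @proj_continuous _ _ i v _ (open_nbhs_nbhs (conj oU Uvi)).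
apply: (@filterS _ (nbhs v) _ _ _ _ Un) => w /= Uwi wi; rewrite elts_indt//.
by exists (w i) => //; apply: mem_pts; rewrite finset.inE.
Qed.

Lemma open_inside n (U : set V) : open U ->
  open [set I : Ind E n | forall x, x \in elts I -> U x].
Proof.
move=> oU; apply: (open_Ind packE) => v vi /=; rewrite elts_indt// => Uv.
have Un i : \forall y \near v i, U y.
  by apply: open_nbhs_nbhs; split => //; apply: Uv; apply: mem_pts.
apply: filterS (near_coord (P := fun _ => U) Un) => w /= Uw wi x.
by rewrite elts_indt// => /in_ptsP[i _ ->].
Qed.

Lemma finite_separation (A : {fset V}) x : x \notin A ->
  exists U W : set V, [/\ open U, open W, U x, (forall y, y \in A -> W y) &
    forall y, U y -> ~ W y].
Proof.
move=> xA; have sepP y : exists UW : set V * set V, y \in A ->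
    [/\ open UW.1, open UW.2, UW.1 x, UW.2 y & forall z, UW.1 z -> ~ UW.2 z].
  have [yA|yA] := boolP (y \in A); last by exists (setT, setT).
  have xy : x != y by apply: contraNneq xA => ->.
  have := vertex_hausdorff packE; rewrite open_hausdorff => /(_ _ _ xy).
  move=> [[U W] /= [/set_mem Ux /set_mem Wy] [oU oW /eqP UW]].
  by exists (U, W) => _; split => //= z Uz Wz; rewrite -[False]/(set0 z) -UW.
have [f fP] := choice sepP.
exists (\bigcap_(y in [set` A]) (f y).1)°, (\bigcup_(y in [set` A]) (f y).2); split.
- exact: open_interior.
- by apply: bigcup_open => y /fP[].
- apply: filter_bigI => y /fP[oU _ Ux _ _]; exact: open_nbhs_nbhs.
- by move=> y yA; exists y => //; have [] := fP y yA.
- move=> z /interior_subset Uz [y yA Wz].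
  by have [_ _ _ _ /(_ z (Uz y yA))] := fP y yA.
Qed.

(** If [x] lies in [I] and not in [J], separate [x] from the finite set [J] by
    [U] and [W]: meeting [U] and being contained in [W] are disjoint open
    conditions. *)
Lemma hausdorff_Ind n : hausdorff_space (Ind E n).
Proof.
rewrite open_hausdorff => I J /eqP IJ.
suff sep (I' J' : Ind E n) x : x \in elts I' -> x \notin elts J' ->
    exists U W : set (Ind E n),
      [/\ open U, open W, U I', W J' & forall K, U K -> ~ W K].
  have [IsJ|/fsubsetPn[x xI xJ]] := boolP (elts I `<=` elts J)%fset; last first.
    have [U [W [oU oW UI WJ UW]]] := sep I J x xI xJ.
    exists (U, W); first by rewrite !inE.
    by split => //; apply/eqP/seteqP; split => // K [/UW].
  have [JsI|/fsubsetPn[x xJ xI]] := boolP (elts J `<=` elts I)%fset; last first.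
    have [U [W [oU oW UI WJ UW]]] := sep J I x xJ xI.
    exists (W, U); first by rewrite !inE.
    by split => //; apply/eqP/seteqP; split => // K [] + /UW.
  by exfalso; apply: IJ; apply: elts_inj; apply/eqP; rewrite eqEfsubset IsJ.
move=> xI xJ; have [U [W [oU oW Ux WJ UW]]] := finite_separation xJ.
exists [set K | exists2 y, y \in elts K & U y], [set K | forall y, y \in elts K -> W y].
split; [exact: open_meets|exact: open_inside|by exists x|by []|].
by move=> K [y yK /UW Wy] /(_ y yK).
Qed.

Hypothesis compactV : compact [set: V].

(** The independent tuples are a closed subset of the compact space [V^n], and
    [Ind E n] is their image together with the empty set. *)
Lemma compact_Ind n : compact [set: Ind E n].
Proof.
have -> : [set: Ind E n] = [set Ind0 E n] `|` indt E @` [set w : {ptws 'I_n -> V} | indep_tuple E w].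
  apply/seteqP; split => // I _; have [I0|] := eqVneq (elts I) fset0.
    by left; apply: elts_inj.
  by move=> /exists_indt[v vi ->]; right; exists v.
apply: compactU; first exact: compact_set1.
apply: continuous_compact.
  apply/subspace_continuousP => v vi U hU.
  have an : (#|[set: 'I_n]%SET| <= n)%N by rewrite cardsT card_ord.
  have hU' : nbhs (mkInd E n (pts v [set: 'I_n]%SET)) U by exact: hU.
  exact: (near_mkInd vi an hU').
apply: (@subclosed_compact _ _ [set: {ptws 'I_n -> V}]) => //.
  rewrite -openC openE => v /= vi; exact: near_not_indep.
have := @tychonoff _ (fun _ : 'I_n => V) (fun=> setT) (fun=> compactV).
by congr compact; apply/seteqP; split.
Qed.

Lemma continuous_card (R : realType) n (h : nat -> R) :
  continuous (fun I : Ind E n => h #|` elts I|).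
Proof.
apply: (continuous_Ind packE) => v vi U hU.
by apply: filterS (near_card packE vi) => w wv wi; rewrite wv//; exact: nbhs_singleton.
Qed.

End ind_separation.

(** Compactness passes from a cover by neighbourhoods to finitely many
    Urysohn functions, whose sum is positive and can be divided out. *)
Lemma partition_of_unity (R : realType) (X : ptopologicalType) (O : X -> set X) :
  hausdorff_space X -> compact [set: X] -> (forall x, nbhs x (O x)) ->
  exists (T : finType) (p : T -> X) (phi : T -> X -> R),
    [/\ forall i, continuous (phi i), forall i x, 0 <= phi i x,
        forall i x, phi i x != 0 -> O (p i) x &
        forall x, \sum_i phi i x = 1].
Proof.
move=> hX cX nO; have normX := compact_normal hX cX.
have /choice[f fP] x : exists g : X -> R, [/\ continuous g, forall y, 0 <= g y,
    0 < g x & forall y, g y != 0 -> O x y].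
  have [|||f [cf f0 f1 fr]] := @urysohn_ext_itv X R normX (~` (O x)°) [set x] 0 1 _ _ _ ltr01.
  - by apply: open_closedC; exact: open_interior.
  - by apply: accessible_closed_set1; exact: hausdorff_accessible.
  - by apply/seteqP; split => // y [/= + yx]; rewrite yx; apply; exact: nO.
  exists f; split => //.
  - by move=> y; have /fr := imageT f y; rewrite /= in_itv /= => /andP[].
  - by have -> : f x = 1 by apply: f1; exists x.
  - move=> y fy; apply: interior_subset; apply: contrapT => /= Oy.
    by move/eqP: fy; apply; apply: f0; exists y.
have [D _ DX] : finite_subset_cover setT (fun x => f x @^-1` [set z | 0 < z]) [set: X].
  have := cX; rewrite compact_cover; apply.
  - move=> x _; have [cf _ _ _] := fP x.
    by apply: open_comp; [move=> y _; exact: cf | exact: open_gt].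
  - by move=> x _; exists x => //=; have [] := fP x.
pose S y := \sum_(i : D) f (val i) y.
have S0 y : 0 < S y.
  have [x xD fxy] := DX y I; rewrite /S (bigD1 [` xD]%fset)//=.
  by apply: ltr_wpDr => //; apply: sumr_ge0 => i _; have [] := fP (val i).
have cS : continuous S.
  have addC : continuous (fun x : R * R => x.1 + x.2) by exact: add_continuous.
  by move=> y; apply: (cvg_big addC) => i _; have [cf _ _ _] := fP (val i); exact: cf.
exists D, val, (fun i y => f (val i) y / S y); split.
- move=> i y; have [cf _ _ _] := fP (val i).
  apply: cvgM; first exact: cf.
  by apply: cvgV; [rewrite gt_eqF | exact: cS].
- by move=> i y; have [_ f0 _ _] := fP (val i); rewrite divr_ge0// ltW.
- move=> i y; rewrite mulf_eq0 negb_or => /andP[fy _].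
  by have [_ _ _ fO] := fP (val i); exact: fO.
- by move=> y; rewrite -mulr_suml divff//; exact: lt0r_neq0 (S0 y).
Qed.

(** * Nonnegative Radon charges and their images under piecewise maps *)

Section finite_measures.
Context d (X : measurableType d) (R : realType).
Variable mu : {measure set X -> \bar R}.
Hypothesis muT : (mu setT < +oo)%E.

Lemma bounded_integrable (D : set X) (f : X -> R) (M : R) :
  measurable D -> measurable_fun D f -> (forall x, `|f x| <= M) ->
  mu.-integrable D (EFin \o f).
Proof.
move=> mD mf fM; apply: measurable_bounded_integrable => //.
  by apply: le_lt_trans muT; apply: le_measure; rewrite ?inE.
rewrite /= /bounded_near; near=> N => x _ /=.
by apply: le_trans (fM x) _; near: N; apply: nbhs_pinfty_ge; exact: num_real.
Unshelve. all: by end_near. Qed.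

Lemma integral_mrestr (D : set X) (mD : measurable D) (f : X -> R) :
  measurable_fun setT f ->
  (\int[mrestr mu mD]_x (f x)%:E = \int[mu]_(x in D) (f x)%:E)%E.
Proof.
move=> mf.
have mDC := measurableC mD.
rewrite -[X in integral _ X _](setUv D) integral_setU //; last 2 first.
- by rewrite setUv; exact/measurable_EFinP.
- by rewrite disj_set2E setICr.
rewrite [X in (_ + X)%E]null_set_integral// ?adde0; last 2 first.
- by apply: measurable_funTS; exact/measurable_EFinP.
- by rewrite /= /mrestr setICl measure0.
apply: eq_measure_integral => A mA AD /=.
by rewrite /mrestr setIidl.
Qed.

End finite_measures.

Section push.
Context (X Y : ptopologicalType) (R : realType).
Variable mu : {measure set (borel X) -> \bar R}.
Hypothesis muT : (mu setT < +oo)%E.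

(** Measurability of [rho] on [D], in a form that only asks for the preimages that
    occur in image measures. *)
Definition Borel_on (D : set (borel X)) (rho : X -> Y) : Prop :=
  forall B : set (borel Y), measurable B -> measurable (D `&` rho @^-1` B).

(** The value of [rho] outside [D] is replaced by a constant, after which the
    image measure under a globally measurable map is available. *)
Lemma push_piece (D : set (borel X)) (rho : X -> Y) :
  measurable D -> Borel_on D rho ->
  exists m : {measure set (borel Y) -> \bar R},
    (forall B : set (borel Y), measurable B -> m B = mu (D `&` rho @^-1` B)) /\
    forall (f : borel Y -> R) M, measurable_fun setT f -> (forall y, `|f y| <= M) ->
      (\int[m]_y (f y)%:E = \int[mu]_x ((f \o rho) \_ D x)%:E)%E.
Proof.
move=> mD mrho.
pose rho' (x : borel X) : borel Y := if x \in D then rho x else point.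
have rhoE B : rho' @^-1` B = (D `&` rho @^-1` B) `|` (~` D `&` [set _ | B point]).
  apply/seteqP; split => x /=; rewrite /rho'; case: ifPn => [/set_mem Dx|/negP Dx].
  - by left.
  - by right; split => // /mem_set.
  - by case=> -[].
  - by case=> -[// Dx']; exfalso; apply: Dx; exact: mem_set.
have mrho' : measurable_fun setT rho'.
  move=> _ B mB; rewrite setTI rhoE; apply: measurableU; first exact: mrho.
  apply: measurableI; first exact: measurableC.
  have [Bp|Bp] := pselect (B point).
    by rewrite (_ : [set _ | _] = setT)//; apply/seteqP; split.
  by rewrite (_ : [set _ | _] = set0)//; apply/seteqP; split.
pose m : {measure set (borel Y) -> \bar R} :=
  measure_function_pushforward__canonical__measure_function_Measure
    (mrestr mu mD) mrho'.
exists m; split.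
  move=> B mB; rewrite /= /pushforward /mrestr; congr (mu _).
  rewrite rhoE; apply/seteqP; split => [x [[[]|[]]]//|x [Dx Bx]].
  by split => //; left.
move=> f M mf fM.
have mfr : measurable_fun setT (f \o rho') by exact: measurableT_comp.
rewrite (integral_pushforward mrho')//=; last 2 first.
- exact/measurable_EFinP.
- rewrite preimage_setT; apply: (bounded_integrable _ (M := M)) => //=.
    apply: le_lt_trans muT; rewrite /mrestr; apply: le_measure; rewrite ?inE//.
    exact: measurableI.
rewrite preimage_setT integral_mrestr//.
rewrite integral_mkcond; apply: eq_integral => x _.
rewrite /patch; case: ifPn => // xD.
by rewrite /= /rho' xD.
Qed.

Definition push_density (T : Type) (r : seq T) (D : T -> set X) (rho : T -> X -> Y)
    (f : Y -> R) (x : X) : R :=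
  \sum_(i <- r) ((f \o rho i) \_ (D i)) x.

Lemma push_sum (T : Type) (r : seq T) (D : T -> set (borel X)) (rho : T -> X -> Y) :
  (forall i, measurable (D i)) -> (forall i, Borel_on (D i) (rho i)) ->
  exists m : {measure set (borel Y) -> \bar R},
    (forall B : set (borel Y), measurable B ->
       m B = \sum_(i <- r) mu (D i `&` rho i @^-1` B))%E /\
    forall (f : borel Y -> R) M, measurable_fun setT f -> (forall y, `|f y| <= M) ->
      (\int[m]_y (f y)%:E = \int[mu]_x (push_density r D rho f x)%:E)%E.
Proof.
move=> mD mrho; elim: r => [|i r [m [mE mI]]].
  exists mzero; split => [B mB|f M mf fM]; first by rewrite big_nil.
  rewrite integral_measure_zero.
  under eq_integral do rewrite /push_density big_nil.
  by rewrite integral0.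
have [n [nE nI]] := push_piece (mD i) (mrho i).
have fin (k : {measure set (borel Y) -> \bar R}) s :
    (forall B, measurable B -> k B = \sum_(i <- s) mu (D i `&` rho i @^-1` B))%E ->
    (k setT < +oo)%E.
  move=> ->//; apply: lte_sum_pinfty => j _; apply: le_lt_trans muT.
  by apply: le_measure; rewrite ?inE//; exact: mrho.
exists (measure_add n m); split => [B mB|f M mf fM].
  by rewrite [LHS]measure_addE (mE B mB) (nE B mB) big_cons.
have i1 : n.-integrable setT (EFin \o f).
  apply: (bounded_integrable _ (M := M)) => //; apply: (fin n [:: i]) => B mB.
  by rewrite big_seq1 nE.
have i2 : m.-integrable setT (EFin \o f).
  by apply: (bounded_integrable _ (M := M)) => //; exact: fin mE.
rewrite [LHS](integral_measure_add _ i1 i2)//.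
have mpatch j : measurable_fun setT ((f \o rho j) \_ (D j) : borel X -> R).
  apply/(measurable_restrictT _ (mD j)) => _ B mB.
  have := mf measurableT B mB; rewrite setTI => mfB.
  exact: (mrho j _ mfB).
have patchM j x : `|((f \o rho j) \_ (D j)) x| <= M.
  by rewrite /patch; case: ifP => _; rewrite ?fM// normr0 (le_trans _ (fM point)).
rewrite (mI _ M)// (nI _ M)//.
under [RHS]eq_integral do rewrite /push_density big_cons EFinD.
rewrite integralD//.
  by apply: (bounded_integrable muT (M := M)).
apply: (bounded_integrable muT (M := M *+ size r)) => //.
  by rewrite /push_density; apply: measurable_sum.
move=> x; apply: le_trans (ler_norm_sum _ _ _) _.
by apply: le_trans (ler_sum _ (fun j _ => patchM j x)) _; rewrite big_const_seq count_predT iter_addr_0.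
Qed.

End push.

Section nonneg_charges.
Context {R : realType} {X : ptopologicalType}.
Variable nu : {charge set (borel X) -> \bar R}.
Hypothesis nu0 : nonneg_charge nu.

Definition posm : {measure set (borel X) -> \bar R} := jordan_pos (hahn_posneg nu).

(** The charge is nonnegative, and nonpositive on its Hahn-negative set. *)
Lemma jordan_neg0 (A : set (borel X)) :
  measurable A -> jordan_neg (hahn_posneg nu) A = 0%E.
Proof.
move=> mA; rewrite jordan_negE cjordan_negE /crestr0 mem_set// /crestr.
have [_ [mN negN] _ _] := hahn_posneg nu.
have mAN : measurable (A `&` hahn_neg nu) by exact: measurableI.
suff -> : nu (A `&` hahn_neg nu) = 0%E by rewrite oppe0.
apply/eqP; rewrite eq_le nu0// andbT.
by apply: negN => // x [].
Qed.

Lemma posmE (A : set (borel X)) : measurable A -> posm A = nu A.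
Proof.
move=> mA; rewrite (jordan_decomp (hahn_posneg nu) mA).
by rewrite /cadd /= /cscale /= jordan_neg0// mule0 adde0.
Qed.

Lemma posm_lty : (posm setT < +oo)%E.
Proof.
rewrite posmE//; have : nu setT \is a fin_num by exact: fin_num_measure.
by rewrite fin_numE lt_neqAle leey => /andP[_ ->].
Qed.

Lemma total_variationE (A : set (borel X)) : measurable A ->
  Defs.total_variation nu A = nu A.
Proof.
move=> mA; rewrite /Defs.total_variation /charge_variation jordan_neg0//= adde0.
exact: posmE.
Qed.

Lemma pairingE f : pairing nu f = \int[posm]_x f x.
Proof.
rewrite /pairing [X in _ - X](_ : _ = 0) ?subr0// /Rintegral.
rewrite (eq_measure_integral mzero) ?integral_measure_zero// => A mA _.
exact: jordan_neg0.
Qed.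

Lemma le_charge (A B : set (borel X)) : measurable A -> measurable B ->
  A `<=` B -> (nu A <= nu B)%E.
Proof. by move=> mA mB AB; rewrite -!posmE//; apply: le_measure; rewrite ?inE. Qed.

Lemma bounded_pairing (f : X -> R) M : measurable_fun (setT : set (borel X)) f ->
  (forall x, `|f x| <= M) -> posm.-integrable setT (EFin \o f).
Proof. by move=> mf fM; apply: (bounded_integrable posm_lty (M := M)). Qed.

Hypothesis hX : hausdorff_space X.

Lemma open_borel (U : set X) : open U -> measurable (U : set (borel X)).
Proof. by move=> oU; apply: sub_sigma_algebra. Qed.

Lemma compact_borel (K : set X) : compact K -> measurable (K : set (borel X)).
Proof.
move=> /(compact_closed hX)/closed_openC/open_borel/measurableC.
by rewrite setCK.
Qed.

Definition inner_regular : Prop := forall (A : set (borel X)) (e : R),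
  measurable A -> 0 < e ->
  exists K : set X, [/\ compact K, K `<=` A & (nu (A `\` K) < e%:E)%E].

Lemma radon_inner_regular : radon nu -> inner_regular.
Proof.
move=> rnu A e mA e0; have [K [U [cK oU KA AU]]] := rnu A e mA e0.
have mK := compact_borel cK; have mU := open_borel oU.
rewrite total_variationE; last exact: measurableD.
move=> UK; exists K; split => //; apply: le_lt_trans UK.
by apply: le_charge; [exact: measurableD|exact: measurableD|exact: setSD].
Qed.

(** Outer regularity of [A] is inner regularity of its complement, since compact
    sets are closed. *)
Lemma inner_regular_radon : inner_regular -> radon nu.
Proof.
move=> rnu A e mA e0; have e2 : 0 < e / 2 by rewrite divr_gt0.
have [K [cK KA AK]] := rnu A _ mA e2.
have [L [cL LA AL]] := rnu (~` A) _ (measurableC mA) e2.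
have mK := compact_borel cK; have mL := compact_borel cL.
exists K, (~` L); split => //.
- by apply: closed_openC; exact: compact_closed.
- by move=> x Ax Lx; exact: (LA x).
have mD : measurable ((~` L : set (borel X)) `\` K).
  by apply: measurableD => //; exact: measurableC.
rewrite total_variationE//.
have mD1 : measurable (A `\` (K : set (borel X))) by exact: measurableD.
have mD2 : measurable (~` A `\` (L : set (borel X))).
  by apply: measurableD => //; exact: measurableC.
apply: (@le_lt_trans _ _ (nu (A `\` K) + nu (~` A `\` L))%E); last first.
  by rewrite [ltRHS](_ : _ = ((e / 2)%:E + (e / 2)%:E)%E) ?lteD// -EFinD -splitr.
rewrite -!posmE//; apply: le_trans (measureU2 _ _ _) => //; apply: le_measure.
- by rewrite inE.
- by rewrite inE; exact: measurableU.
- by move=> x [Lx Kx]; have [Ax|Ax] := pselect (A x); [left|right].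
Qed.

End nonneg_charges.

Lemma continuous_borel (X : ptopologicalType) (R : realType) (f : X -> R) :
  continuous f -> measurable_fun (setT : set (borel X)) f.
Proof.
move=> cf; apply: (measurability (@RGenOpens.G R)); first exact: RGenOpens.measurableE.
move=> _ [_ [a [b ->]] <-]; rewrite setTI; apply: open_borel.
by apply: open_comp => [x _|]; [exact: cf|exact: interval_open].
Qed.

Lemma compact_bounded (X : ptopologicalType) (R : realType) (f : X -> R) :
  compact [set: X] -> continuous f -> exists M, forall x, `|f x| <= M.
Proof.
move=> cX cf.
have : compact (f @` setT).
  by apply: continuous_compact => //; exact: continuous_subspaceT.
move=> /compact_bounded[M [_ HM]]; exists (M + 1) => x.
by apply: (HM (M + 1)); rewrite ?ltrDl//; exists x.
Qed.

Lemma continuous_comp_fun (X Y Z : topologicalType) (f : X -> Y) (g : Y -> Z) :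
  continuous f -> continuous g -> continuous (g \o f).
Proof. by move=> cf cg x; apply: continuous_comp; [exact: cf|exact: cg]. Qed.

Lemma continuous_mul (R : realType) (X : topologicalType) (f g : X -> R) :
  continuous f -> continuous g -> continuous (fun x => f x * g x).
Proof. by move=> cf cg x; apply: cvgM; [exact: cf|exact: cg]. Qed.

Lemma continuous_add (R : realType) (X : topologicalType) (f g : X -> R) :
  continuous f -> continuous g -> continuous (fun x => f x + g x).
Proof. by move=> cf cg x; apply: cvgD; [exact: cf|exact: cg]. Qed.

Lemma continuous_sum (R : realType) (X : topologicalType) (I : Type) (r : seq I)
    (P : pred I) (f : I -> X -> R) : (forall i, P i -> continuous (f i)) ->
  continuous (fun x => \sum_(i <- r | P i) f i x).
Proof.
have addC : continuous (fun x : R * R => x.1 + x.2) by exact: add_continuous.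
by move=> cf x; apply: (cvg_big addC) => i Pi; exact: cf.
Qed.

Section pairing_theory.
Context {R : realType} {X : ptopologicalType}.
Variable nu : {charge set (borel X) -> \bar R}.
Hypothesis nu0 : nonneg_charge nu.

Lemma pairing_indic (A : set (borel X)) : measurable A ->
  pairing nu (fun x => (x \in A)%:R) = fine (nu A).
Proof.
move=> mA; rewrite pairingE// /Rintegral -(posmE nu0 mA); congr fine.
by rewrite -[in RHS](setIT A) -integral_indic//; apply: eq_integral => x _; rewrite indicE.
Qed.

Hypothesis cX : compact [set: X].

Lemma continuous_integrable (f : X -> R) :
  continuous f -> (posm nu).-integrable setT (EFin \o f : borel X -> \bar R).
Proof.
move=> cf; have [M fM] := compact_bounded cX cf.
exact: (bounded_pairing nu0 (continuous_borel cf) fM).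
Qed.

Lemma pairing_linear (a : R) (f g : X -> R) : continuous f -> continuous g ->
  pairing nu (fun x => a * f x + g x) = a * pairing nu f + pairing nu g.
Proof.
move=> cf cg; rewrite !pairingE//.
have iaf : (posm nu).-integrable setT (EFin \o (fun x : borel X => a * f x)).
  apply: continuous_integrable => x.
  by apply: cvgM; [exact: cvg_cst | exact: cf].
rewrite RintegralD//; last exact: continuous_integrable.
by rewrite RintegralZl//; exact: continuous_integrable.
Qed.

Lemma le_pairing (f g : X -> R) : continuous f -> continuous g ->
  (forall x, f x <= g x) -> pairing nu f <= pairing nu g.
Proof.
move=> cf cg fg; rewrite !pairingE//.
by apply: le_Rintegral => //; exact: continuous_integrable.
Qed.

End pairing_theory.

Lemma within_continuous_borel (X Y : ptopologicalType) (D : set (borel X)) (rho : X -> Y) :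
  measurable D -> {within (D : set X), continuous rho} -> Borel_on D rho.
Proof.
move=> mD crho.
have mrho : measurable_fun D (rho : borel X -> borel Y).
  apply: (@measurability _ _ (borel X) (borel Y) D _ (@open Y)) => [|_ [U oU <-]]; first exact: erefl.
  have /open_subspaceP[W oW WD] : open (rho @^-1` U : set (subspace (D : set X))).
    by move/continuousP : crho; apply.
  rewrite setIC -WD; apply: measurableI => //; exact: open_borel.
by move=> B mB; exact: mrho.
Qed.

Section radon_push.
Context {R : realType} {X Y : ptopologicalType}.
Hypotheses (hX : hausdorff_space X).
Hypotheses (hY : hausdorff_space Y) (cY : compact [set: Y]).
Variable nu : {charge set (borel X) -> \bar R}.
Hypotheses (nu0 : nonneg_charge nu) (rnu : radon nu).

(** The images of compact sets under a map that is continuous on [D i] are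
    compact, which is what makes the image charge regular. *)
Lemma radon_push (T : finType) (D : T -> set (borel X)) (rho : T -> X -> Y) :
  (forall i, measurable (D i)) ->
  (forall i, {within (D i : set X), continuous (rho i)}) ->
  exists mu : {charge set (borel Y) -> \bar R},
    [/\ nonneg_charge mu, radon mu,
      (forall B : set (borel Y), measurable B ->
        mu B = \sum_i nu (D i `&` rho i @^-1` B))%E &
      forall f, continuous f -> pairing mu f = pairing nu (push_density (index_enum T) D rho f)].
Proof.
move=> mD crho.
have mrho i : Borel_on (D i) (rho i) by exact: within_continuous_borel.
have [m [mE mI]] := push_sum (posm_lty nu0) (index_enum T) mD mrho.
have {}mE (B : set (borel Y)) : measurable B ->
    m B = (\sum_i nu (D i `&` rho i @^-1` B))%E.
  by move=> mB; rewrite mE//; apply: eq_bigr => i _; rewrite posmE//; exact: mrho.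
have fin : fin_num_fun m.
  move=> B mB; rewrite mE//; apply: (big_ind (fun x => x \is a fin_num)) => //.
    by move=> x y xf yf; rewrite fin_numD xf.
  by move=> i _; apply: fin_num_measure; exact: mrho.
have sf : sigma_finite setT m by apply: fin_num_fun_sigma_finite; rewrite ?measure0.
pose H1 := isFinite.Build _ _ _ (Measure.sort m) fin.
pose H2 := isSFinite.Build _ _ _ (Measure.sort m) (sfinite_measure_sigma_finite sf).
pose H3 := isSigmaFinite.Build _ _ _ (Measure.sort m) sf.
pose m' : {finite_measure set (borel Y) -> \bar R} :=
  HB.pack_for (FiniteMeasure.type (borel Y) R) (Measure.sort m) H1 H2 H3.
pose mu : {charge set (borel Y) -> \bar R} := charge_of_finite_measure m'.
have muE (B : set (borel Y)) : mu B = m B by [].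
have mu0 : nonneg_charge mu by move=> B mB; rewrite muE; exact: measure_ge0.
exists mu; split => //.
- apply: inner_regular_radon => // B e mB e0.
  pose e' := e / #|T|.+1%:R; have e'0 : 0 < e' by rewrite divr_gt0.
  have /choice[K KP] i := radon_inner_regular nu0 hX rnu (mrho i _ mB) e'0.
  pose L := \big[setU/set0]_(i : T) (rho i @` K i).
  have LE x : L x <-> exists2 i, True & (rho i @` K i) x.
    rewrite /L -bigcup_seq; split => [[i _ Kx]|[i _ Kx]]; exists i => //.
    by rewrite /= mem_index_enum.
  have cK i : compact (rho i @` K i).
    have [cK KD _] := KP i; apply: continuous_compact => //.
    by apply: continuous_subspaceW (crho i) => x /KD[].
  have cL : compact L by apply: bigsetU_compact.
  have mL := compact_borel hY cL; have mBL : measurable (B `\` (L : set (borel Y))) by exact: measurableD.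
  exists L; split => //.
    by move=> x /LE[i _ [y Ky <-]]; have [_ /(_ y Ky)[]] := KP i.
  rewrite muE mE//; apply: (@le_lt_trans _ _ (\sum_(i : T) e'%:E)%E).
    apply: lee_sum => i _; have [cKi KD KB] := KP i.
    have mKi := compact_borel hX cKi.
    apply: ltW; apply: le_lt_trans KB; apply: le_charge => //.
    - exact: mrho.
    - by apply: measurableD => //; exact: mrho.
    - move=> x [Dx [Bx Lx]]; split => // Kx; apply: Lx; apply/LE.
      by exists i => //; exists x.
  rewrite sumEFin lte_fin sumr_const -mulr_natr /e' mulrAC.
  by rewrite ltr_pdivrMr// ltr_pM2l// ltr_nat.
- move=> f cf; have [M fM] := compact_bounded cY cf.
  have mf' := continuous_borel cf.
  rewrite !pairingE// /Rintegral; congr fine.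
  rewrite -(mI f M)//; apply: eq_measure_integral => A mA _.
  by rewrite posmE.
Qed.

End radon_push.

(** * The independence number *)

Section independence_number.
Context {V : ptopologicalType} {E : set (V * V)}.
Hypotheses (packE : packing_graph E) (compactV : compact [set: V]).

Lemma clique_cover : exists (T : finType) (U : T -> set V),
  [/\ forall i, open (U i), forall i, clique E (U i) & forall x, exists i, U i x].
Proof.
have /choice[U UP] x : exists U : set V, [/\ open U, clique E U & U x].
  have [|U [oU cU] xU] := open_clique packE (finite_set1 x).
    by move=> ? ? /= -> ->.
  by exists U; split => //; exact: xU.
have [D _ DX] : finite_subset_cover setT U [set: V].
  have := compactV; rewrite compact_cover; apply.
    by move=> x _; have [] := UP x.
  by move=> x _; exists x => //; have [] := UP x.
exists D, (fun i => U (val i)); split.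
- by move=> i; have [] := UP (val i).
- by move=> i; have [] := UP (val i).
- by move=> x; have [y yD Uy] := DX x I; exists [` yD]%fset.
Qed.

(** An independent set has at most one point in each member of a finite cover by
    cliques. *)
Lemma bounded_indep : exists m, forall S : {fset V},
  independent E [set` S] -> (#|` S| <= m)%N.
Proof.
have [T [U [_ cU /choice[f fU]]]] := clique_cover.
exists #|T| => S iS.
have fI : {in S &, injective f}.
  move=> x y xS yS fxy; apply: contrapT => xy; apply: (iS x y) => //.
  by apply: (cU (f x)) => //; rewrite fxy.
have uf : uniq (map f (enum_fset S)) by rewrite map_inj_in_uniq// fset_uniq.
rewrite [X in (X <= _)%N](_ : _ = size (map f (enum_fset S))) ?size_map//.
by rewrite -(size_map f) -(card_uniqP uf) max_card.
Qed.

Lemma indep_number_spec :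
  (exists2 S : {fset V}, independent E [set` S] & #|` S| = indep_number E) /\
  (forall S : {fset V}, independent E [set` S] -> (#|` S| <= indep_number E)%N).
Proof.
have [m bm] := bounded_indep.
pose P n := `[< exists2 S : {fset V}, independent E [set` S] & #|` S| = n >].
have P0 : exists n, P n.
  by exists 0%N; apply/asboolP; exists fset0; rewrite ?cardfs0// => x y; rewrite /= in_fset0.
have Pm n : P n -> (n <= m)%N by move=> /asboolP[S iS <-]; exact: bm.
have fin (A : set V) : independent E A -> finite_set A.
  move=> iA; apply: contrapT => /(infinite_set_fset m.+1)[B BA mB].
  suff : (m < m)%N by rewrite ltnn.
  apply: (leq_trans mB); apply: bm => x y xB yB.
  by apply: iA; exact: BA.
have ex : exists n, [set n | (exists2 A, independent E A & A #= `I_n)%card /\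
    (forall A, independent E A -> A #<= `I_n)%card] n.
  case: (@ex_maxnP P m P0 Pm) => n /asboolP[S iS Sn] maxn; exists n; split.
    by exists [set` S] => //; apply/card_eq_fsetP.
  move=> A iA; have /finite_fsetP[S' AS'] := fin _ iA.
  have iS' : independent E [set` S'] by rewrite -AS'.
  have S'n : (#|` S'| <= n)%N by apply: maxn; apply/asboolP; exists S'.
  have : ([set` S'] #= `I_(#|` S'|))%card by apply/card_eq_fsetP.
  rewrite AS' card_eq_le => /andP[+ _] => /card_le_trans; apply.
  by rewrite card_le_II.
have [[A iA An] Amax] : [set n | (exists2 A, independent E A & A #= `I_n)%card /\
    (forall A, independent E A -> A #<= `I_n)%card] (indep_number E) := xgetPex 0%N ex.
have /finite_fsetP[S AS] := fin _ iA; move: iA An; rewrite AS => iS Sn.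
split; first by exists S => //; apply/card_eq_fsetP.
move=> S' iS'; have := Amax _ iS'.
have : ([set` S'] #= `I_(#|` S'|))%card by apply/card_eq_fsetP.
by rewrite card_eq_le => /andP[_ S'S] /(card_le_trans S'S); rewrite card_le_II.
Qed.

End independence_number.

(** * The block hierarchy at large order *)

Lemma sum_card_subset (R : pzRingType) (L : finType) (T : {set L}) (f : nat -> R) :
  \sum_(A : {set L} | A \subset T) f #|A| =
  \sum_(j < #|T|.+1) ('C(#|T|, j))%:R * f j.
Proof.
have card_ord_T (A : {set L}) : A \subset T -> (#|A| < #|T|.+1)%N.
  by move=> /subset_leq_card.
rewrite (partition_big (fun A : {set L} => inord #|A| : 'I_(#|T|.+1)) predT)//=.
apply: eq_bigr => j _.
have -> : ('C(#|T|, j))%:R =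
    \sum_(A : {set L} | (A \subset T) && (#|A| == j :> nat)) 1 :> R.
  by rewrite -cards_draws -sum1dep_card natr_sum.
rewrite mulr_suml big_mkcond [RHS]big_mkcond; apply: eq_bigr => A _.
have [AT|] := boolP (A \subset T) => //=.
rewrite -val_eqE /= inordK ?card_ord_T//.
by case: eqVneq => [->|//]; rewrite mul1r.
Qed.

(** The zeta transform on the lattice of finite sets is inverted by induction on
    size. *)
Lemma subset_sum_inj (R : zmodType) (L : finType) (G H : {set L} -> R) :
  (forall T : {set L}, \sum_(A : {set L} | A \subset T) G A =
             \sum_(A : {set L} | A \subset T) H A) -> G =1 H.
Proof.
move=> GH T; elim: {T}_.+1 {-2}T (ltnSn #|T|) => // k IH T Tk.
have := GH T; rewrite (bigD1 T)//= [in RHS](bigD1 T)//=.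
rewrite [X in _ + X = _](_ : _ = \sum_(A : {set L} | (A \subset T) && (A != T)) H A).
  by move/addIr.
apply: eq_bigr => A /andP[AT AnT]; apply: IH.
rewrite -ltnS; apply: leq_trans Tk; rewrite ltnS; apply: proper_card.
by rewrite finset.properEneq AnT.
Qed.

Section certificate.
Context {R : realType}.
Implicit Types (a : R) (q k : nat).

Definition weight a (j : nat) : R := if j is 0 then - a else 1.

(** The numbers [certificate a q k] are the Moebius inverse of
    ['C(k, q) * (k - a) ^ 2]. *)
Definition certificate a q k : R :=
  (k == q)%:R * (q%:R - a) ^+ 2 +
  (k == q.+1)%:R * (q.+1%:R * (2 * (q%:R - a) + 1)) +
  (k == q.+2)%:R * (q.+2%:R * q.+1%:R).

Lemma sum_bin_delta k p (x : R) :
  \sum_(j < k.+1) ('C(k, j))%:R * ((nat_of_ord j == p)%:R * x) = 'C(k, p)%:R * x.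
Proof.
have [pk|kp] := leqP p k; last first.
  rewrite bin_small// mul0r big1// => j _; rewrite (negbTE (_ : _ != _)) ?mul0r ?mulr0//.
  by rewrite neq_ltn (leq_ltn_trans _ kp)// -ltnS.
rewrite (bigD1 (inord p))//= inordK// eqxx mul1r big1 ?addr0// => j.
rewrite -val_eqE /= inordK// => /negbTE ->.
by rewrite mul0r mulr0.
Qed.

Lemma sum_certificate a q k :
  \sum_(j < k.+1) ('C(k, j))%:R * certificate a q j =
  'C(k, q)%:R * (k%:R - a) ^+ 2.
Proof.
under eq_bigr do rewrite /certificate mulrDr mulrDr.
rewrite !big_split /= !sum_bin_delta.
have [qk|kq] := leqP q k; last first.
  by rewrite !bin_small ?mul0r ?addr0// ltnW// ltnW.
have b1 : 'C(k, q.+1)%:R * q.+1%:R = 'C(k, q)%:R * (k%:R - q%:R) :> R.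
  by rewrite -natrB// -!natrM mulnC mul_bin_left mulnC.
have b2 : 'C(k, q.+2)%:R * (q.+2%:R * q.+1%:R) =
    'C(k, q)%:R * (k%:R - q%:R) * (k%:R - q%:R - 1) :> R.
  have [->|kq] := eqVneq k q.
    by rewrite bin_small// subrr !(mulr0, mul0r).
  have lt : (q < k)%N by rewrite ltn_neqAle eq_sym kq.
  rewrite -b1 mulrA -!natrM [('C(k, q.+2) * _)%N]mulnC mul_bin_left.
  rewrite -[_ - _ - 1]addrA -opprD natr1 -natrB// -!natrM; congr (_%:R).
  by rewrite [RHS]mulnC mulnA.
rewrite b2 [X in _ + X + _]mulrA b1; ring.
Qed.

End certificate.

Section cover_sums.
Context {R : realType} {L : finType}.
Implicit Types (A B C T : {set L}).

Lemma sum_weight (a : R) T :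
  \sum_(A : {set L} | (#|A| <= 1)%N && (A \subset T)) weight a #|A| = #|T|%:R - a.
Proof.
transitivity (\sum_(A : {set L} | A \subset T) (#|A| <= 1)%N%:R * weight a #|A|).
  rewrite big_mkcondl; apply: eq_bigr => A _.
  by case: leqP; rewrite ?mul1r ?mul0r.
rewrite (sum_card_subset T (fun j => (j <= 1)%N%:R * weight a j)).
transitivity (\sum_(j < #|T|.+1) ('C(#|T|, j)%:R * ((j == 0%N :> nat)%:R * (- a)) +
    'C(#|T|, j)%:R * ((j == 1%N :> nat)%:R * 1))).
  apply: eq_bigr => -[[|[|j]] jT] _ /=; rewrite !(mul0r, mulr0, mul1r, addr0, add0r)//.
by rewrite big_split /= !sum_bin_delta bin0 bin1 mul1r mulr1 addrC.
Qed.

(** Summed over the subsets of [T], the left side becomes the product of the sums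
    over [A], [B] and [C], that is ['C(#|T|, q) * (#|T| - a) ^ 2]. *)
Lemma sum_cover3_weight (a : R) c q T : (q <= c)%N ->
  \sum_(t | cover3 1 1 c T t)
    (#|t.2| == q)%:R * weight a #|t.1.1| * weight a #|t.1.2| =
  certificate a q #|T|.
Proof.
move=> qc; move: T; apply: subset_sum_inj => T.
rewrite (sum_card_subset T (certificate a q)) sum_certificate.
pose w (t : {set L} * {set L} * {set L}) : R :=
  (#|t.2| == q)%:R * weight a #|t.1.1| * weight a #|t.1.2|.
pose P (t : {set L} * {set L} * {set L}) := [&& #|t.1.1| <= 1, #|t.1.2| <= 1,
  #|t.2| <= c & t.2 :|: t.1.1 :|: t.1.2 \subset T]%N%SET.
have -> : \sum_(A : {set L} | A \subset T) \sum_(t | cover3 1 1 c A t) w t =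
    \sum_(t | P t) w t.
  rewrite [RHS](partition_big (fun t => t.2 :|: t.1.1 :|: t.1.2)%SET
    (fun A : {set L} => A \subset T)); last by move=> t /and4P[].
  apply: eq_bigr => A AT; apply: eq_bigl => t.
  rewrite /cover3 /P; case: eqVneq => [->|_]; first by rewrite AT !andbT.
  by rewrite !andbF.
pose small (j : nat) A := (#|A| <= j)%N && (A \subset T).
transitivity (\sum_(t | small 1%N t.1.1 && small 1%N t.1.2 && small c t.2) w t).
  apply: eq_bigl => t; rewrite /P /small !finset.subUset.
  by case: (_ <= 1)%N; case: (_ <= 1)%N; case: (_ <= c)%N; rewrite ?(andbF, andbT)//=;
     case: (t.1.1 \subset T); case: (t.1.2 \subset T); case: (t.2 \subset T).
rewrite -(pair_big_dep (fun p => small 1%N p.1 && small 1%N p.2) (fun _ C => small c C) (fun p C => w (p, C)))/=.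
rewrite -(pair_big_dep (small 1%N) (fun _ B => small 1%N B) (fun A B => \sum_(C | small c C) w (A, B, C)))/=.
have sC : \sum_(C | small c C) (#|C| == q)%:R = 'C(#|T|, q)%:R :> R.
  rewrite -cards_draws -sum1dep_card natr_sum /small.
  rewrite big_mkcond [RHS]big_mkcond; apply: eq_bigr => C _.
  have [CT|] := boolP (C \subset T); rewrite ?andbF ?andbT//=.
  by case: eqVneq => [->|]; rewrite ?qc// if_same.
transitivity (\sum_(A | small 1%N A) \sum_(B | small 1%N B)
    ('C(#|T|, q)%:R * weight a #|A| * weight a #|B|)).
  apply: eq_bigr => A _; apply: eq_bigr => B _; rewrite -sC !mulr_suml.
  by apply: eq_bigr => C _.
under eq_bigr do rewrite -mulr_sumr sum_weight.
by rewrite -mulr_suml -mulr_sumr sum_weight expr2 mulrA.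
Qed.

End cover_sums.

Section block_moment_le.
Context {R : realType} {V : ptopologicalType} {E : set (V * V)}.
Hypotheses (packE : packing_graph E) (compactV : compact [set: V]).

Lemma enum_ind n (I : Ind E n) : exists s : 'I_(#|` elts I|) -> V,
  injective s /\ elts I = pts s finset.setT.
Proof.
exists (fun i => nth point (elts I) i); split.
  move=> i j /eqP; rewrite nth_uniq ?fset_uniq// => /eqP ij; exact: val_inj.
apply/fsetP => x; apply/idP/in_ptsP => [xI|[i _ ->]]; last exact: mem_nth.
have lx : (index x (elts I) < #|` elts I|)%N by rewrite index_mem.
by exists (Ordinal lx); rewrite ?finset.inE//= nth_index.
Qed.

(** For each [Q] a nonnegative multiple of a rank one kernel. *)
Definition certificate_kernel (a : R) (q c : nat) (t : Ind E 1 * Ind E 1 * Ind E c) : R :=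
  (#|` elts t.2| == q)%:R * weight a #|` elts t.1.1| * weight a #|` elts t.1.2|.

Lemma certificate_kernel_psd a q c :
  Csym3_psd (Ind E 1) (Ind E c) (certificate_kernel a q (c := c)).
Proof.
split; first split.
- have c11 : continuous (fun t : Ind E 1 * Ind E 1 * Ind E c => t.1.1).
    by apply: continuous_comp_fun => ?; exact: cvg_fst.
  have c12 : continuous (fun t : Ind E 1 * Ind E 1 * Ind E c => t.1.2).
    apply: (continuous_comp_fun (f := fst) (g := snd)) => ?; [exact: cvg_fst|exact: cvg_snd].
  have c2 : continuous (fun t : Ind E 1 * Ind E 1 * Ind E c => t.2).
    by move=> ?; exact: cvg_snd.
  apply: continuous_mul; first apply: continuous_mul.
  + exact: (continuous_comp_fun c2 (continuous_card packE (h := fun j => (j == q)%:R : R))).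
  + exact: (continuous_comp_fun c11 (continuous_card packE (h := weight a))).
  + exact: (continuous_comp_fun c12 (continuous_card packE (h := weight a))).
- by apply/funext => -[[J J'] Q]; rewrite /certificate_kernel /= mulrAC.
- move=> Q n x b.
  rewrite (_ : \sum_(i < n) _ = (#|` elts Q| == q)%:R *
    (\sum_(i < n) b i * weight a #|` elts (x i)|) ^+ 2).
    by rewrite mulr_ge0// sqr_ge0.
  rewrite expr2 mulr_suml mulr_sumr; apply: eq_bigr => i _.
  rewrite mulr_sumr mulr_sumr; apply: eq_bigr => j _.
  by rewrite /certificate_kernel /=; ring.
Qed.

Lemma opB_certificate a q n (I : Ind E n) : (q <= n - 2)%N ->
  opB (certificate_kernel a q (c := n - 2)) I = certificate a q #|` elts I|.
Proof.
move=> qn; have [s [sI eI]] := enum_ind I.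
rewrite [LHS](fiber3_sum (in2W sI) eI) -[in RHS](card_ord #|` elts I|) -cardsT.
rewrite -(sum_cover3_weight a [set: 'I__]%SET qn); apply: eq_bigr => t /and4P[t1 t2 t3 _].
have cE A : #|` pts s A| = #|A| by apply: (card_pts (in2W sI)); exact: finset.subsetT.
by rewrite /certificate_kernel/= !(elts_sub_mkInd eI) ?finset.subsetT// !cE.
Qed.

Lemma ind_eq0 n : @ind_eq V E n 0 = [set Ind0 E n].
Proof.
apply/seteqP; split => [I /= /eqP|I ->]; last by exact: cardfs0.
by rewrite cardfs_eq0 => /eqP I0; apply: elts_inj.
Qed.

Lemma measurable_ind_eq n k : measurable (ind_eq k : set (borel (Ind E n))).
Proof. by apply: open_borel; exact: (@open_card _ _ packE n (fun j => j = k)). Qed.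

Lemma pairing_certificate n (nu : {charge set (borel (Ind E n)) -> \bar R}) a q :
  nonneg_charge nu ->
  pairing nu (fun I => certificate a q #|` elts I|) =
  (q%:R - a) ^+ 2 * fine (nu (ind_eq q)) +
  q.+1%:R * (2 * (q%:R - a) + 1) * fine (nu (ind_eq q.+1)) +
  q.+2%:R * q.+1%:R * fine (nu (ind_eq q.+2)).
Proof.
move=> nu0; have cI := @compact_Ind _ _ packE compactV n.
pose d (k : nat) (I : Ind E n) : R := (#|` elts I| == k)%:R.
have cd k : continuous (d k) by exact: (continuous_card packE (h := fun j => (j == k)%:R)).
have dE k : pairing nu (d k) = fine (nu (ind_eq k)).
  rewrite -(pairing_indic nu0 (@measurable_ind_eq n k)); congr pairing; apply/funext => I.
  rewrite /d; suff -> : (I \in ind_eq k) = (#|` elts I| == k) by [].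
  by apply/idP/eqP => [/set_mem//|h]; apply/mem_set.
have -> : (fun I : Ind E n => certificate a q #|` elts I|) = (fun I =>
    (q%:R - a) ^+ 2 * d q I + (q.+1%:R * (2 * (q%:R - a) + 1) * d q.+1 I +
      (q.+2%:R * q.+1%:R * d q.+2 I + 0))).
  by apply/funext => I; rewrite /certificate /d; ring.
have c0 : continuous (fun _ : Ind E n => 0 : R) by exact: cst_continuous.
have cZ x k (f : Ind E n -> R) : continuous f -> continuous (fun I => x * d k I + f I).
  move=> cf; apply: continuous_add => //; apply: continuous_mul => //.
  exact: cst_continuous.
have c1 := cZ (q.+2%:R * q.+1%:R) q.+2 _ c0.
have c2 := cZ (q.+1%:R * (2 * (q%:R - a) + 1)) q.+1 _ c1.
rewrite (pairing_linear nu0 cI _ (cd q) c2).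
rewrite (pairing_linear nu0 cI _ (cd q.+1) c1).
rewrite (pairing_linear nu0 cI _ (cd q.+2) c0).
rewrite !dE (_ : pairing nu (fun=> 0) = 0); last first.
  rewrite (_ : (fun=> 0) = (fun I : borel (Ind E n) => (I \in set0)%:R : R)).
    by rewrite pairing_indic// charge0.
  by apply/funext => I; rewrite in_set0.
ring.
Qed.

(** The hypothesis on [q] is the positivity of a feasible measure on
    [certificate_kernel], with [N k] the mass of the sets of size [k].  Multiplying
    the bound on [N q.+2] by [q.+1] and substituting it into the hypothesis leaves
    [(a - q) * (q.+1 * N q.+1) <= (a - q) ^ 2 * N q]. *)
Lemma block_feasible_chain (a n : nat) (N : nat -> R) :
  (a < n)%N -> (forall k, 0 <= N k) -> N a.+1 = 0 ->
  (forall q, (q < a)%N -> 0 <= (q%:R - a%:R) ^+ 2 * N q +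
    q.+1%:R * (2 * (q%:R - a%:R) + 1) * N q.+1 + q.+2%:R * q.+1%:R * N q.+2) ->
  N 1%N <= a%:R * N 0%N.
Proof.
move=> an N0 Na H.
suff main q : (q <= a)%N -> q.+1%:R * N q.+1 <= (a%:R - q%:R) * N q.
  by have := main 0%N (leq0n _); rewrite subr0 mul1r.
move=> qa; rewrite -(subKn qa); elim: (a - q)%N {qa} => [|j IH].
  by rewrite subn0 Na mulr0 subrr mul0r.
have [ja|aj] := leqP a j.
  by have -> : (a - j.+1 = a - j)%N by lia.
pose p := (a - j.+1)%N.
have pE : (a - j)%N = p.+1 by rewrite /p subnSK.
have pa : (p < a)%N by rewrite -pE leq_subr.
rewrite -/p; move: IH; rewrite pE => IH; have {}H := H _ pa.
set x := (a%:R - p%:R : R); have x0 : 0 < x by rewrite subr_gt0 ltr_nat.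
have pS : p.+1%:R = p%:R + 1 :> R by rewrite natr1.
rewrite -(ler_pM2l x0) -subr_ge0.
have xE : p%:R - a%:R = - x by rewrite /x opprB.
move: H IH; rewrite xE => H.
rewrite (_ : a%:R - p.+1%:R = x - 1); last by rewrite pS /x; ring.
move=> /(ler_wpM2l (ler0n R p.+1)) IH.
rewrite (_ : _ - _ = ((- x) ^+ 2 * N p +
  p.+1%:R * (2 * - x + 1) * N p.+1 + p.+2%:R * p.+1%:R * N p.+2) +
  (p.+1%:R * ((x - 1) * N p.+1) - p.+1%:R * (p.+2%:R * N p.+2))); last by ring.
by rewrite addr_ge0// subr_ge0.
Qed.

(** Only the certificates with [q < a] are used, so that [a < n] puts them in the
    range [q <= n - 2] of the block operator. *)
Lemma block_moment_le_indep n : (indep_number E < n)%N ->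
  (block_moment R E n <= (indep_number E)%:R%:E)%E.
Proof.
set a := indep_number E => an.
apply: ge_ereal_sup => _ [nu [_ nu0 nu1 [mu [_ mupos] adj]] <-].
pose N k := fine (nu (ind_eq k)).
have NE k : nu (ind_eq k) = (N k)%:E.
  by rewrite /N fineK//; apply: fin_num_measure; exact: measurable_ind_eq.
rewrite NE lee_fin.
suff : N 1%N <= a%:R * N 0%N by rewrite /N ind_eq0 nu1 /= mulr1.
apply: (block_feasible_chain an).
- by move=> k; rewrite -lee_fin -NE; apply: nu0; exact: measurable_ind_eq.
- rewrite /N (_ : ind_eq _ = set0) ?charge0//; apply/seteqP; split => // I /= Ia.
  have := (indep_number_spec packE compactV).2 _ (elts_indep (I := I)).
  by rewrite Ia ltnn.
- move=> q qa; rewrite -(pairing_certificate _ _ nu0).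
  have qn : (q <= n - 2)%N by rewrite leq_subRL; lia.
  have -> : (fun I : Ind E n => certificate a%:R q #|` elts I|) =
      opB (certificate_kernel a%:R q (c := n - 2)).
    by apply/funext => I; rewrite (opB_certificate _ _ qn).
  have psdF := certificate_kernel_psd (a%:R : R) q (n - 2).
  by rewrite -(adj _ psdF.1); exact: mupos.
Qed.

End block_moment_le.

(** * Atomic charges *)

Lemma hausdorff_prod (X Y : topologicalType) :
  hausdorff_space X -> hausdorff_space Y -> hausdorff_space (X * Y)%type.
Proof.
move=> hX hY [x y] [x' y'] cl; congr (_, _).
  apply: hX => A B Ax Bx'.
  have nA : nbhs (x, y) (fst @^-1` A) by apply: cvg_fst.
  have nB : nbhs (x', y') (fst @^-1` B) by apply: cvg_fst.
  by have [p [Ap Bp]] := cl _ _ nA nB; exists p.1.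
apply: hY => A B Ay By'.
have nA : nbhs (x, y) (snd @^-1` A) by apply: cvg_snd.
have nB : nbhs (x', y') (snd @^-1` B) by apply: cvg_snd.
by have [p [Ap Bp]] := cl _ _ nA nB; exists p.2.
Qed.

Lemma compact_prod (X Y : topologicalType) :
  compact [set: X] -> compact [set: Y] -> compact [set: (X * Y)%type].
Proof. by move=> cX cY; rewrite -setXTT; exact: compact_setX. Qed.

Lemma closed_diag (X : topologicalType) :
  hausdorff_space X -> closed [set p : X * X | p.1 = p.2].
Proof.
move=> hX; rewrite -openC openE => -[x y] /= /eqP xy.
move: hX; rewrite open_hausdorff => /(_ _ _ xy) [[A B] /= [/set_mem Ax /set_mem By]].
move=> [oA oB /eqP AB]; exists (A, B) => /=.
  by split; apply: open_nbhs_nbhs.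
move=> [z t] /= [Az Bt] zt; rewrite -[False]/(set0 z) -AB; split => //.
by rewrite zt.
Qed.

Lemma continuous_swap (X : topologicalType) :
  continuous (@swap X : X * X -> X * X).
Proof. by move=> x; apply: cvg_pair; [exact: cvg_snd|exact: cvg_fst]. Qed.

Lemma continuous_swap3 (X Y : topologicalType) :
  continuous (@swap3 X Y : X * X * Y -> X * X * Y).
Proof.
have c1 : continuous ((@swap X) \o fst : X * X * Y -> X * X).
  by apply: continuous_comp_fun => x; [exact: cvg_fst|exact: continuous_swap].
by move=> x; exact: (cvg_pair (c1 x) cvg_snd).
Qed.

Lemma continuous_borel_map (X Y : ptopologicalType) (f : X -> Y) (A : set (borel Y)) :
  continuous f -> measurable A -> measurable (f @^-1` A : set (borel X)).
Proof.
move=> cf mA; rewrite -[X in measurable X]setTI.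
apply: (@within_continuous_borel X Y) => //; exact: continuous_subspaceT.
Qed.

Section atomic.
Context {R : realType} {Y : ptopologicalType}.
Hypotheses (hY : hausdorff_space Y) (cY : compact [set: Y]).

Lemma pairing_cst (nu : {charge set (borel Y) -> \bar R}) (c : R) :
  nonneg_charge nu -> pairing nu (fun=> c) = c * fine (nu setT).
Proof.
move=> nu0; rewrite pairingE// -(posmE nu0 measurableT).
by rewrite Rintegral_cst.
Qed.

Lemma point_charge (m : R) : 0 <= m ->
  exists nu : {charge set (borel Y) -> \bar R},
    [/\ nonneg_charge nu, radon nu & nu setT = m%:E].
Proof.
move=> m0; pose y : borel Y := (point : Y).
pose nu : {charge set (borel Y) -> \bar R} :=
  cscale m (charge_of_finite_measure (dirac y : {finite_measure set (borel Y) -> \bar R})).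
have nuE A : nu A = (m%:E * \d_y A)%E by [].
have nu0 : nonneg_charge nu by move=> A mA; rewrite nuE mule_ge0// lee_fin.
exists nu; split => //; last by rewrite nuE diracT mule1.
apply: inner_regular_radon => // A e mA e0.
have [Ay|Ay] := pselect (A y).
  exists [set (y : Y)]; split; [exact: compact_set1|by move=> _ ->|].
  rewrite nuE diracE (_ : y \in _ = false) ?mule0//.
  by apply/negbTE/negP => /set_mem[_]; apply.
exists set0; split; [exact: compact0|by []|].
rewrite nuE diracE (_ : y \in _ = false) ?mule0//.
by apply/negbTE/negP => /set_mem[].
Qed.

Lemma atomic_charge (T : finType) (P : pred T) (p : T -> Y) (m : R) : 0 <= m ->
  exists mu : {charge set (borel Y) -> \bar R},
    [/\ nonneg_charge mu, radon mu,
      forall B : set (borel Y), measurable B ->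
        mu B = (m * \sum_(i | P i) (p i \in (B : set Y))%:R)%:E &
      forall f, continuous f -> pairing mu f = m * \sum_(i | P i) f (p i)].
Proof.
move=> m0; have [nu [nu0 rnu nuT]] := point_charge m0.
pose D i : set (borel Y) := if P i then setT else set0.
have mD i : measurable (D i) by rewrite /D; case: ifP.
have [|mu [mu0 rmu muE muI]] := radon_push hY hY cY nu0 rnu mD (rho := fun i _ => p i).
  by move=> i; apply: continuous_subspaceT; exact: cst_continuous.
exists mu; split => //.
- move=> B mB; rewrite muE// mulr_sumr -sumEFin [RHS]big_mkcond; apply: eq_bigr => i _.
  rewrite /D; case: ifPn => Pi; last by rewrite set0I charge0.
  rewrite setTI; have [Bp|Bp] := boolP (p i \in (B : set Y)).
    rewrite mulr1 -nuT; congr (nu _); apply/seteqP; split => // x _.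
    exact: set_mem Bp.
  rewrite mulr0 (_ : _ @^-1` _ = set0) ?charge0//.
  by apply/seteqP; split => // x /= /mem_set; rewrite (negbTE Bp).
- move=> f cf; rewrite muI//.
  have -> : push_density (index_enum T) D (fun i _ => p i) f = fun=> \sum_(i | P i) f (p i).
    apply/funext => x; rewrite /push_density [RHS]big_mkcond; apply: eq_bigr => i _.
    by rewrite /patch /D /=; case: (P i); rewrite ?in_setT ?in_set0.
  by rewrite pairing_cst// nuT mulrC.
Qed.

End atomic.

(** * Lower bounds for theta *)

Section theta_lower_bound.
Context {R : realType} {V : ptopologicalType} {E : set (V * V)}.
Hypotheses (packE : packing_graph E) (compactV : compact [set: V]).
Variable r : nat.

(** The measures that bound theta from below have the form [m] times the sum of the
    point masses at [p i]; the symmetry of the family [p] is witnessed by [tau]. *)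
Lemma theta_atomic (T : finType) (p : T -> V * V) (tau : T -> T) (m : R) :
  0 <= m -> injective tau -> (forall i, p (tau i) = swap (p i)) ->
  (forall i, ~ E (p i)) ->
  m * \sum_i ((p i).1 == (p i).2)%:R = 1 ->
  (forall F, Ccop R V r F -> 0 <= \sum_i F (p i)) ->
  ((m * #|T|%:R)%:E <= theta E (Msym_dual (Ccop R V r)))%E.
Proof.
move=> m0 tauI ptau pE pdiag pF.
have hV := vertex_hausdorff packE.
have hVV := hausdorff_prod hV hV; have cVV := compact_prod compactV compactV.
have [mu [mu0 rmu muE muI]] := @atomic_charge R _ hVV cVV T xpredT p m m0.
have muT : mu setT = (m * #|T|%:R)%:E.
  rewrite muE//; congr (_ * _)%:E; under eq_bigr do rewrite in_setT.
  by rewrite sumr_const.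
rewrite -muT; apply: ereal_sup_ubound; exists mu => //; split.
- split; last by move=> F CF; rewrite muI; [rewrite mulr_ge0// pF|exact: CF.1.1].
  split => // A mA; rewrite !muE//; last first.
    exact: (continuous_borel_map (@continuous_swap V)).
  congr (_ * _)%:E; rewrite [RHS](reindex_inj tauI) /=; apply: eq_bigr => i _.
  by rewrite ptau.
- move=> A mA AE; rewrite muE// big1 ?mulr0// => i _.
  have [/set_mem/AE|//] := boolP (p i \in (A : set (V * V))); by move/pE.
- have md : measurable ([set q : V * V | q.1 = q.2] : set (borel (V * V)%type)).
    rewrite -[X in measurable X]setCK; apply: measurableC; apply: open_borel.
    by apply: closed_openC; exact: closed_diag.
  rewrite muE//; congr (_%:E); rewrite -[RHS]pdiag; congr (_ * _); apply: eq_bigr => i _.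
  by congr (_%:R); congr nat_of_bool; apply/idP/eqP => [/set_mem|?]; [|apply/mem_set].
Qed.

Lemma indep_enum k : (k <= indep_number E)%N ->
  exists s : 'I_k -> V, injective s /\ indep_tuple E s.
Proof.
have [[S iS Sn] _] := indep_number_spec packE compactV; move=> kn.
have lt (i : 'I_k) : (i < size S)%N by rewrite (leq_trans (ltn_ord i))// [size S]Sn.
exists (fun i => nth point S i); split.
  move=> i j /eqP; rewrite nth_uniq ?fset_uniq// => /eqP ij; exact: val_inj.
by move=> i j; apply: iS; rewrite /= mem_nth.
Qed.

Lemma indep_number_gt0 : (0 < indep_number E)%N.
Proof.
have [_ ] := indep_number_spec packE compactV.
move=> /(_ [fset point]%fset); rewrite cardfs1; apply.
by move=> x y /= /fset1P -> /fset1P ->; exact: edge_irr.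
Qed.

(** The indicator of the event factors over the coordinates of [f]; the product
    on the right is left unevaluated, since only its positivity and its
    independence of [i] and [j] matter. *)
Lemma count_pairs (L : finType) (k : nat) (a b : 'I_k) (i j : L) : a != b ->
  \sum_(f : {ffun 'I_k -> L} | (f a == i) && (f b == j)) 1 =
  \prod_(x < k) (if (x == a) || (x == b) then 1 else #|L|%:R) :> R.
Proof.
move=> ab.
pose g (x : 'I_k) (l : L) : R := ((x == a) ==> (l == i))%:R * ((x == b) ==> (l == j))%:R.
transitivity (\prod_(x < k) \sum_(l : L) g x l).
  rewrite bigA_distr_bigA big_mkcond; apply: eq_bigr => f _.
  case: ifPn => [/andP[/eqP fa /eqP fb]|].
    apply/esym; apply: big1 => x _; rewrite /g.
    have -> : ((x == a) ==> (f x == i)) by apply/implyP => /eqP ->; apply/eqP.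
    have -> : ((x == b) ==> (f x == j)) by apply/implyP => /eqP ->; apply/eqP.
    by rewrite mulr1.
  rewrite negb_and => /orP[] /negbTE fN.
    by rewrite (bigD1 a)//= /g eqxx /= fN !mul0r.
  by rewrite (bigD1 b)//= /g eqxx /= fN mulr0 mul0r.
apply: eq_bigr => x _; rewrite /g; have [->|xa] := eqVneq x a.
  rewrite (negbTE ab) /= (bigD1 i)//= eqxx mulr1 big1 ?addr0// => l /negbTE ->.
  by rewrite mul0r.
have [_|_] := eqVneq x b => /=.
  rewrite (bigD1 j)//= eqxx mulr1 big1 ?addr0// => l /negbTE ->.
  by rewrite mulr0.
by rewrite (eq_bigr (fun=> 1)) ?sumr_const// => l _; rewrite mulr1.
Qed.

(** Averaging [T_r F] over all maps from the indices to [L], that is over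
    independent uniform samples with replacement. *)
Lemma Ccop_sum_ge0 (L : finType) (s : L -> V) (F : V * V -> R) :
  (0 < #|L|)%N -> Ccop R V r F -> 0 <= \sum_i \sum_j F (s i, s j).
Proof.
move=> L0 [_ TF].
pose K (p : 'S_r.+2) : R := \prod_(x < r.+2)
  (if (x == p ord0) || (x == p (lift ord0 ord0)) then 1 else #|L|%:R).
have K0 p : 0 < K p by apply: prodr_gt0 => x _; case: ifP => // _; rewrite ltr0n.
have main : \sum_(f : {ffun 'I_r.+2 -> L}) opT F (s \o f) =
    (r.+2)`!%:R^-1 * ((\sum_p K p) * \sum_i \sum_j F (s i, s j)).
  rewrite -mulr_sumr; congr (_ * _); rewrite exchange_big mulr_suml /=.
  apply: eq_bigr => p _.
  have pne : p ord0 != p (lift ord0 ord0) by rewrite (inj_eq perm_inj).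
  rewrite pair_big /= mulr_sumr.
  rewrite (partition_big (fun f : {ffun 'I_r.+2 -> L} => (f (p ord0), f (p (lift ord0 ord0)))) predT)//=.
  apply: eq_bigr => -[i j] _ /=.
  have -> : K p = _ := esym (count_pairs i j pne).
  rewrite mulr_suml; apply: eq_big => [f|f /eqP[-> ->]].
    by rewrite xpair_eqE.
  by rewrite mul1r.
have : 0 <= \sum_(f : {ffun 'I_r.+2 -> L}) opT F (s \o f) by apply: sumr_ge0 => f _; exact: TF.
rewrite main pmulr_rge0 ?invr_gt0 ?ltr0n ?fact_gt0// pmulr_rge0//.
rewrite (bigD1 1%g)//= ltr_pwDl// sumr_ge0// => p _; exact: ltW.
Qed.

Lemma theta_ge_indep :
  ((indep_number E)%:R%:E <= theta E (Msym_dual (Ccop R V r)))%E.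
Proof.
have [s [sI si]] := indep_enum (leqnn _); set a := indep_number E in s sI si *.
have a0 : a%:R != 0 :> R by rewrite pnatr_eq0 -lt0n indep_number_gt0.
have := @theta_atomic ('I_a * 'I_a)%type (fun i => (s i.1, s i.2))
  (fun i => (i.2, i.1)) a%:R^-1.
rewrite card_prod card_ord natrM mulrA mulVf// mul1r; apply.
- by rewrite invr_ge0.
- by move=> [i j] [k l] [-> ->].
- by [].
- by move=> i; exact: si.
- rewrite -(pair_bigA _ (fun i j => (s i == s j)%:R))/=.
  rewrite (eq_bigr (fun=> 1)) ?sumr_const ?card_ord ?mulVf// => i _.
  rewrite (bigD1 i)//= eqxx big1 ?addr0// => j ji.
  by rewrite (inj_eq sI) eq_sym (negbTE ji).
- move=> F CF; rewrite -(pair_bigA _ (fun i j => F (s i, s j)))/=.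
  by apply: Ccop_sum_ge0; rewrite // card_ord indep_number_gt0.
Qed.

(** On an independent set with [r.+2] points [T_r] puts no weight on the
    diagonal, so that any multiple of the resulting measure may be added to a
    point mass on the diagonal. *)
Lemma theta_pinfty : (r.+2 <= indep_number E)%N ->
  theta E (Msym_dual (Ccop R V r)) = +oo%E.
Proof.
move=> /indep_enum[s [sI si]]; apply/eqyP => A A0.
(* [None] is the point mass on the diagonal; the other indices are [c] copies
   of the off-diagonal measure, where [c] exceeds the bound [A] to beat. *)
pose c := (Num.truncn A).+1.
have Ac : A <= c%:R by apply: ltW; exact: truncnS_gt.
pose p (o : option ('I_c * 'S_r.+2)) := if o is Some (_, q)
  then (s (q ord0), s (q (lift ord0 ord0))) else (s ord0, s ord0).
pose t : 'S_r.+2 := tperm ord0 (lift ord0 ord0).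
pose tau (o : option ('I_c * 'S_r.+2)) := if o is Some (k, q)
  then Some (k, (t * q)%g) else None.
have tau_inj : injective tau.
  by move=> [[k q]|] [[k' q']|]//= [-> /mulgI ->].
have ptau i : p (tau i) = swap (p i).
  by case: i => [[k q]|]//=; rewrite !permM tpermL tpermR.
have pE i : ~ E (p i) by case: i => [[k q]|] /=; exact: si.
have sum_option (f : option ('I_c * 'S_r.+2) -> R) :
    \sum_o f o = f None + \sum_k \sum_q f (Some (k, q)).
  rewrite (bigD1 None)//= pair_bigA; congr (_ + _).
  rewrite (reindex_onto Some (odflt (ord0, 1%g)))/=; last by case.
  by apply: eq_big => [k|[k q] _]; rewrite ?eqxx.
have pdiag : 1 * \sum_i ((p i).1 == (p i).2)%:R = 1 :> R.
  rewrite mul1r sum_option /= eqxx big1 ?addr0// => k _; apply: big1 => q _.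
  by rewrite (inj_eq sI) (inj_eq perm_inj).
have pF F : Ccop R V r F -> 0 <= \sum_i F (p i).
  move=> CF; rewrite sum_option /= addr_ge0//.
    have := @Ccop_sum_ge0 'I_1 (fun=> s ord0) F; rewrite card_ord.
    by move=> /(_ isT CF); rewrite !big_ord1.
  apply: sumr_ge0 => k _; have [_ /(_ s)] := CF.
  by rewrite /opT pmulr_rge0// invr_gt0 ltr0n fact_gt0.
apply: le_trans (theta_atomic ler01 tau_inj ptau pE pdiag pF).
rewrite lee_fin mul1r; apply: (le_trans Ac); rewrite ler_nat card_option card_prod card_ord.
rewrite leqW// leq_pmulr//; apply/card_gt0P; by exists 1%g.
Qed.

End theta_lower_bound.

(** * Lower bound for the moment hierarchy *)

Lemma psd_fin (R : realType) (X : Type) (F : X -> X -> R) (T : finType)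
    (x : T -> X) (c : T -> R) : psd F ->
  0 <= \sum_i \sum_j c i * c j * F (x i) (x j).
Proof.
move=> psdF; rewrite (big_enum_val (A := T)) /=.
under eq_bigr do rewrite (big_enum_val (A := T)) /=.
exact: (psdF _ (fun i => x (enum_val i)) (fun i => c (enum_val i))).
Qed.

Section moment_lower_bound.
Context {R : realType} {V : ptopologicalType} {E : set (V * V)}.
Hypotheses (packE : packing_graph E) (compactV : compact [set: V]).

(** The point masses at the subsets of a maximum independent set [S] are
    feasible, and their image under the adjoint of [A_k] is the product of two
    copies of the counting measure on the small subsets of [S]. *)
Lemma indep_le_moment k : (0 < k)%N ->
  ((indep_number E)%:R%:E <= moment R E k)%E.
Proof.
move=> k0; have [s [sI si]] := indep_enum packE compactV (leqnn _).
set a := indep_number E in s sI si *.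
have hI n := hausdorff_Ind packE (n := n); have cI n := @compact_Ind _ _ packE compactV n.
pose p n (A : {set 'I_a}) := mkInd E n (pts s A).
have pE n (A : {set 'I_a}) : (#|A| <= n)%N -> elts (p n A) = pts s A.
  by move=> An; apply: elts_mkInd; exact: is_ind_pts.
have cE (A : {set 'I_a}) : #|` pts s A| = #|A| by apply: (card_pts (in2W sI)); exact: finset.subsetT.
pose P n (A : {set 'I_a}) := (#|A| <= n)%N.
have [nu [nu0 rnu nuE nuI]] := @atomic_charge R _ (hI _) (cI _) _ (P (2 * k)%N) (p (2 * k)%N) _ ler01.
pose P2 (AB : {set 'I_a} * {set 'I_a}) := P k AB.1 && P k AB.2.
pose p2 (AB : {set 'I_a} * {set 'I_a}) := (p k AB.1, p k AB.2).
have [mu [mu0 rmu muE muI]] := @atomic_charge R _ (hausdorff_prod (hI k) (hI k))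
  (compact_prod (cI k) (cI k)) _ P2 p2 _ ler01.
have nu1 : nu (ind_eq 1) = a%:R%:E.
  rewrite nuE; last exact: measurable_ind_eq.
  rewrite mul1r; congr (_%:E).
  transitivity (\sum_(A : {set 'I_a} | #|A| == 1%N) 1%N%:R : R).
    rewrite big_mkcond [RHS]big_mkcond; apply: eq_bigr => A _.
    case: ifPn => [Ak|Ak]; last by case: eqP => // A1; move: Ak; rewrite /P A1 muln_gt0 k0.
    have -> : (p (2 * k)%N A \in ind_eq 1) = (#|A| == 1%N).
      by apply/idP/eqP => [/set_mem|A1]; [|apply/mem_set]; rewrite /ind_eq /= pE// cE.
    by case: eqP.
  by rewrite -natr_sum sum1dep_card card_draws card_ord bin1.
rewrite -nu1; apply: ereal_sup_ubound; exists nu => //; split => //.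
  rewrite nuE; last first.
    by rewrite -ind_eq0; exact: measurable_ind_eq.
  rewrite mul1r (bigD1 finset.set0)//=; last by rewrite /P cards0.
  rewrite /p pts0 mkInd0 mem_set// big1 ?addr0// => A /andP[Ak A0].
  have [/set_mem /= |//] := boolP (_ \in _).
  move=> /(congr1 (@elts _ _ _)); rewrite pE// => /(congr1 (fun S => #|` S|)).
  by rewrite cE cardfs0 => /eqP; rewrite cards_eq0 (negbTE A0).
exists mu; first split; first split => //.
- move=> A mA; rewrite !muE//; last first.
    exact: (continuous_borel_map (@continuous_swap (Ind E k))).
  congr (_ * _)%:E.
  rewrite [RHS](reindex_inj (h := @swap {set 'I_a})); last by move=> [? ?] [? ?] [-> ->].
  by apply: eq_big => [[B C]|[B C] _] //; rewrite /P2 andbC.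
- move=> F [CF psdF]; rewrite muI; last exact: CF.1.
  rewrite mul1r; have := psd_fin (p k) (fun A => (P k A)%:R) psdF.
  rewrite pair_bigA big_mkcond [X in _ -> _ <= X]big_mkcond.
  move=> h; apply: le_trans h _; rewrite le_eqVlt; apply/orP; left; apply/eqP.
  apply: eq_bigr => -[A B] _; rewrite /P2 /=.
  by case: (P k A); case: (P k B); rewrite ?(mul0r, mul1r).
- move=> F CF; rewrite muI; last exact: CF.1.
  rewrite nuI; last exact: (continuous_fiber2_sum packE CF.1).
  rewrite !mul1r.
  rewrite [LHS](partition_big (fun AB => AB.1 :|: AB.2)%SET (P (2 * k)%N)); last first.
    move=> [A B] /andP[/= Ak Bk]; rewrite /P (leq_trans (leq_card_setU _ _))//.
    by rewrite mul2n -addnn leq_add.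
  apply: eq_bigr => C Ck; rewrite /opA.
  rewrite [RHS](fiber2_sum (I := p (2 * k)%N C) (s := s) (T := C)).
  - by apply: eq_bigl => -[A B]; rewrite /P2 /P /cover2 /= andbA.
  - exact: in2W.
  - exact: pE.
Qed.

End moment_lower_bound.

(** * The adjoint of the block operator *)

Section block_adjoint.
Context {R : realType} {V : ptopologicalType} {E : set (V * V)}.
Hypotheses (packE : packing_graph E) (compactV : compact [set: V]).

Section signatures.
Context {T : finType} (U : T -> set V).
Hypotheses (oU : forall i, open (U i)) (cU : forall i, clique E (U i)).
Hypothesis coverU : forall x, exists i, U i x.

(** The cover [U] labels the points of an independent set canonically, by the set
    of members that contain them. *)
Definition signature (x : V) : {set T} := [set i | `[< U i x >]]%SET.

Definition U_ (sg : {set T}) : set V := \bigcap_(i in [set` sg]) U i.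

Lemma open_U_ sg : open (U_ sg).
Proof.
rewrite openE => x Ux; rewrite /interior.
have H i : nbhs x [set y | i \in sg -> U i y].
  have [isg|isg] := boolP (i \in sg); last by apply: filterE.
  have : nbhs x (U i) by apply: open_nbhs_nbhs; split => //; exact: Ux.
  by apply: filterS => y Uy _.
have Hx := @filter_forall _ T (fun i y => i \in sg -> U i y) (nbhs x) (nbhs_filter x) H.
by apply: (@filterS _ (nbhs x) _ _ _ _ Hx) => y Uy i; exact: Uy.
Qed.

Lemma sub_signature sg x : U_ sg x <-> sg \subset signature x.
Proof.
split=> [Ux|/fintype.subsetP sgx i /= isg].
  by apply/fintype.subsetP => i isg; rewrite finset.inE; apply/asboolP; exact: Ux.
by have := sgx _ isg; rewrite finset.inE => /asboolP.
Qed.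

Lemma signature_neq0 x : signature x != finset.set0.
Proof.
have [i Uix] := coverU x; apply/finset.set0Pn; exists i.
by rewrite finset.inE; apply/asboolP.
Qed.

(** Points of an independent set whose signatures meet lie in a common clique,
    hence coincide. *)
Lemma signature_disjoint n (I : Ind E n) x y i : x \in elts I -> y \in elts I ->
  i \in signature x -> i \in signature y -> x = y.
Proof.
rewrite !finset.inE => xI yI /asboolP Ux /asboolP Uy; apply: contrapT => xy.
exact: (elts_indep xI yI (cU Ux Uy xy)).
Qed.

Definition point_of n (I : Ind E n) (sg : {set T}) : V :=
  nth point (elts I) (find (fun x => signature x == sg) (elts I)).

Definition signatures n (I : Ind E n) : {set {set T}} :=
  [set sg | has (fun x => signature x == sg) (elts I)]%SET.

Lemma mem_signatures n (I : Ind E n) x : x \in elts I -> signature x \in signatures I.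
Proof. by move=> xI; rewrite finset.inE; apply/hasP; exists x. Qed.

Lemma point_ofP n (I : Ind E n) sg : sg \in signatures I ->
  point_of I sg \in elts I /\ signature (point_of I sg) = sg.
Proof.
rewrite finset.inE => h; split; first by rewrite mem_nth// -has_find.
exact/eqP/(nth_find point h).
Qed.

Lemma signature_inj n (I : Ind E n) x y : x \in elts I -> y \in elts I ->
  signature x = signature y -> x = y.
Proof.
move=> xI yI xy; have /finset.set0Pn[i ix] := signature_neq0 x.
by apply: (signature_disjoint xI yI ix); rewrite -xy.
Qed.

Lemma point_of_signature n (I : Ind E n) x : x \in elts I ->
  point_of I (signature x) = x.
Proof.
move=> xI; have [pI ps] := point_ofP (mem_signatures xI).
exact: (signature_inj pI xI ps).
Qed.

Lemma point_of_inj n (I : Ind E n) : {in signatures I &, injective (point_of I)}.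
Proof.
move=> s t /point_ofP[_ sE] /point_ofP[_ tE] st.
by rewrite -sE -tE st.
Qed.

Lemma elts_point_of n (I : Ind E n) : elts I = pts (point_of I) (signatures I).
Proof.
apply/fsetP => x; apply/idP/in_ptsP => [xI|[sg /point_ofP[pI _] ->]//].
by exists (signature x); rewrite ?mem_signatures// point_of_signature.
Qed.

Definition with_signatures n (S : {set {set T}}) : set (Ind E n) :=
  [set I | signatures I = S].

(** The signatures of [I] in terms of which open sets [I] meets, which makes the
    sets [with_signatures] Borel. *)
Lemma mem_signaturesE n (I : Ind E n) sg : sg \in signatures I <->
  [/\ sg != finset.set0, exists2 x, x \in elts I & U_ sg x &
    forall j, j \notin sg -> ~ exists2 x, x \in elts I & U_ (j |: sg)%SET x].
Proof.
split=> [/point_ofP[pI ps]|[sg0 [x xI Ux] H]].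
  split; first by rewrite -ps signature_neq0.
    by exists (point_of I sg) => //; apply/sub_signature; rewrite ps.
  move=> j jsg [y yI /sub_signature]; rewrite finset.subUset finset.sub1set => /andP[jy sgy].
  have /finset.set0Pn[i ip] := signature_neq0 (point_of I sg).
  have iy : i \in signature y by apply: (fintype.subsetP sgy); rewrite -ps.
  by move: jsg; rewrite -ps (signature_disjoint pI yI ip iy) jy.
suff -> : sg = signature x by exact: mem_signatures.
apply/eqP; rewrite finset.eqEsubset; apply/andP; split; first exact/sub_signature.
apply/fintype.subsetP => j jx; apply: contrapT => /negP jsg; apply: (H j jsg).
exists x => //; apply/sub_signature; rewrite finset.subUset finset.sub1set jx.
exact/sub_signature.
Qed.

Lemma measurable_with_signatures n S :
  measurable (with_signatures S : set (borel (Ind E n))).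
Proof.
pose meets sg : set (borel (Ind E n)) := [set I | exists2 x, x \in elts I & U_ sg x].
have mmeets sg : measurable (meets sg) by apply: open_borel; apply: open_meets => //; exact: open_U_.
pose M (sg : {set T}) : set (borel (Ind E n)) := [set I : Ind E n | sg \in signatures I].
have mM sg : measurable (M sg).
  have [sg0|sg0] := boolP (sg == finset.set0).
    rewrite (_ : M sg = set0)//; apply/seteqP; split => // I /mem_signaturesE[].
    by rewrite sg0.
  rewrite (_ : M sg = meets sg `&` \bigcap_(j in [set j | j \notin sg]) ~` meets (j |: sg)%SET).
    apply: measurableI => //; apply: fin_bigcap_measurable => // j _.
    exact: measurableC.
  apply/seteqP; split => [I /mem_signaturesE[_ mI H]|I [mI H]].
    by split => // j jsg; exact: H.
  by apply/mem_signaturesE; split => // j jsg; exact: H.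
rewrite (_ : with_signatures S = \bigcap_(sg in [set: {set T}])
    (if sg \in S then M sg else ~` M sg)).
  apply: fin_bigcap_measurable => // sg _; case: ifP => _ //; exact: measurableC.
apply/seteqP; split => [I IS sg _|I H].
  by case: ifPn; rewrite -IS// => /negP.
apply/finset.setP => sg; have := H sg Logic.I.
by case: ifP => [//|_]; rewrite /M /=; case: (_ \in _).
Qed.

Definition section3 a b c n (t : {set {set T}} * {set {set T}} * {set {set T}})
    (I : Ind E n) : Ind E a * Ind E b * Ind E c :=
  (mkInd E a (pts (point_of I) t.1.1), mkInd E b (pts (point_of I) t.1.2),
   mkInd E c (pts (point_of I) t.2)).

Lemma eq_pts (L : finType) (s s' : L -> V) (A : {set L}) :
  {in A, s =1 s'} -> pts s A = pts s' A.
Proof.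
move=> ss; apply/fsetP => x; apply/in_ptsP/in_ptsP => -[l lA ->]; exists l => //.
  exact: ss.
by rewrite ss.
Qed.

Lemma pts_comp (L M : finType) (w : M -> V) (e : L -> M) (A : {set L}) :
  pts (w \o e) A = pts w (e @: A)%SET.
Proof.
apply/fsetP => x; apply/in_ptsP/in_ptsP => [[l lA ->]|[_ /finset.imsetP[l lA ->] ->]].
  by exists (e l) => //; apply: finset.imset_f.
by exists l.
Qed.

(** Under a perturbation the signature of a point can only grow; when the set of
    signatures stays the same, disjointness forces every signature to stay the
    same, so that the labelled points move continuously. *)
Lemma continuous_section3 a b c n (S : {set {set T}}) t : cover3 a b c S t ->
  {within (with_signatures S : set (Ind E n)), continuous (@section3 a b c n t)}.
Proof.
case: t => [[A B] C] /and4P[/= Aa Bb Cc /eqP ABC].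
have AS : A \subset S by rewrite -ABC finset.subsetU// finset.subsetUr.
have BS : B \subset S by rewrite -ABC finset.subsetUr.
have CS : C \subset S by rewrite -ABC finset.subsetU// finset.subsetUl.
apply/continuousP => W oW; apply/open_subspaceP.
(* The witness only asks for some labelling of [I] by [S] with the points in the
   right open sets, which is an open condition. *)
exists [set I : Ind E n | exists s : {set T} -> V, [/\ forall sg, sg \in S -> U_ sg (s sg),
  elts I = pts s S &
  W (mkInd E a (pts s A), mkInd E b (pts s B), mkInd E c (pts s C))]]; last first.
  apply/seteqP; split => [I [[s [sU sS Ws]] IS]|I [WI IS]]; split => //.
    suff sE : {in S, s =1 point_of I}.
      have sE' (A' : {set {set T}}) : A' \subset S -> pts s A' = pts (point_of I) A'.
        by move=> /fintype.subsetP A'S; apply: eq_pts => l /A'S; exact: sE.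
      by move: Ws; rewrite !sE'.
    move=> sg sgS; have sI : s sg \in elts I by rewrite sS mem_pts.
    have [pI ps] : point_of I sg \in elts I /\ signature (point_of I sg) = sg.
      by apply: point_ofP; rewrite IS.
    have /finset.set0Pn[i ip] := signature_neq0 (point_of I sg).
    apply: (signature_disjoint sI pI (i := i)) => //.
    by have /sub_signature/fintype.subsetP := sU _ sgS; apply; rewrite -ps.
  exists (point_of I); split => //; last by rewrite -IS -elts_point_of.
  by move=> sg; rewrite -IS => /point_ofP[_ ps]; apply/sub_signature; rewrite ps.
case: n => [|n]; apply: (open_Ind packE) => v vi.
  by move=> Hv; apply: filterE => w _; have -> : w = v by apply/funext => -[].
move=> [s [sU]]; rewrite elts_indt// => sS Ws.
have /choice[e eP] sg : exists i : 'I_n.+1, sg \in S -> s sg = v i.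
  have [sgS|] := boolP (sg \in S); last by exists ord0.
  have : s sg \in pts v finset.setT by rewrite sS mem_pts.
  by move=> /in_ptsP[i _ ->]; exists i.
have near_U : \forall w \near v, forall sg, sg \in S -> U_ sg (w (e sg)).
  apply: (@filter_forall _ _ (fun sg (w : {ptws 'I_n.+1 -> V}) => sg \in S -> U_ sg (w (e sg))) (nbhs v)) => sg.
  have [sgS|_] := boolP (sg \in S); last by apply: filterE.
  have Uv : U_ sg (v (e sg)) by rewrite -eP//; exact: sU.
  have := @proj_continuous _ _ (e sg) v _ (open_nbhs_nbhs (conj (open_U_ sg) Uv)).
  by move=> Un; apply: (@filterS _ (nbhs v) _ _ _ _ Un) => w /= Uw _.
have sE (A' : {set {set T}}) : A' \subset S -> pts s A' = pts v (e @: A')%SET.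
  by move=> /fintype.subsetP A'S; rewrite -pts_comp; apply: eq_pts => l /A'S; exact: eP.
have le_im (A' : {set {set T}}) k : (#|A'| <= k)%N -> (#|(e @: A')%SET| <= k)%N.
  exact: leq_trans (leq_imset_card _ _).
rewrite !sE// in Ws.
have near_W : \forall w \near v, indep_tuple E w -> W (mkInd E a (pts w (e @: A)%SET),
    mkInd E b (pts w (e @: B)%SET), mkInd E c (pts w (e @: C)%SET)).
  exact: (cvg_mkInd3 vi (le_im _ _ Aa) (le_im _ _ Bb) (le_im _ _ Cc)
    (open_nbhs_nbhs (conj oW Ws))).
apply: (@filterS3 _ (nbhs v) _ _ _ _ _ _ (near_pattern packE v) near_U near_W).
move=> w wv wU wW wi.
exists (w \o e); split; [exact: wU | | by rewrite (pts_comp w e A) (pts_comp w e B) (pts_comp w e C); exact: wW wi].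
rewrite elts_indt//; apply/fsetP => x; apply/in_ptsP/in_ptsP => [[i _ ->]|[sg _ ->]]; last first.
  by exists (e sg).
have : v i \in pts s S by rewrite -sS mem_pts.
move=> /in_ptsP[sg sgS vis]; exists sg => //=.
by apply/eqP; rewrite (wv wi) vis eP.
Qed.

End signatures.

(** The image of [nu] under the adjoint of the summation over decompositions:
    over the independent sets with a given set of signatures, the decompositions
    form finitely many disjoint sheets. *)
Lemma exists_block_adjoint b c n (nu : {charge set (borel (Ind E n)) -> \bar R}) :
  nonneg_charge nu -> radon nu ->
  exists mu, [/\ nonneg_charge mu, Msym3 (Ind E b) (Ind E c) mu &
    forall F, continuous F ->
      pairing mu F = pairing nu (fun I => \sum_(t \in fiber3 (elts I)) F t)].
Proof.
move=> nu0 rnu; have [T [U [oU cU coverU]]] := clique_cover packE compactV.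
have hI k := hausdorff_Ind packE (n := k); have cI k := @compact_Ind _ _ packE compactV k.
pose Tr := ({set {set T}} * {set {set T}} * {set {set T}})%type.
pose un (t : Tr) := (t.2 :|: t.1.1 :|: t.1.2)%SET.
pose D (t : Tr) : set (borel (Ind E n)) :=
  if cover3 b b c (un t) t then with_signatures U (un t) else set0.
have mD t : measurable (D t).
  by rewrite /D; case: ifP => // _; exact: measurable_with_signatures.
have cs t : {within (D t : set (Ind E n)), continuous (section3 U b b c t)}.
  rewrite /D; case: ifP => [|_]; first exact: continuous_section3.
  by apply/subspace_continuousP => x.
have [mu [mu0 rmu muE muI]] := radon_push (hI _)
  (hausdorff_prod (hausdorff_prod (hI b) (hI b)) (hI c))
  (compact_prod (compact_prod (cI b) (cI b)) (cI c)) nu0 rnu mD cs.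
exists mu; split => //; first split => //.
  move=> A mA; rewrite !muE//; last first.
    exact: (continuous_borel_map (@continuous_swap3 (Ind E b) (Ind E c))).
  pose tau (t : Tr) : Tr := (t.1.2, t.1.1, t.2).
  have tauI : injective tau by move=> [[? ?] ?] [[? ?] ?] [-> -> ->].
  rewrite [RHS](reindex_inj tauI); apply: eq_bigr => -[[A' B'] C'] _.
  have -> : D (tau (A', B', C')) = D (A', B', C').
    by rewrite /D /un /cover3 /= finset.setUAC andbCA.
  by [].
move=> F cF; rewrite muI//; congr pairing; apply/funext => I.
rewrite (fiber3_sum (point_of_inj (U := U) (I := I)) (elts_point_of cU coverU I)).
rewrite /push_density [RHS]big_mkcond; apply: eq_bigr => t _.
rewrite /patch; have [/set_mem|] := boolP (I \in D t).
  by rewrite /D; case: ifP => // ct IS; rewrite [signatures U I]IS ct.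
case: ifP => // ct /negP ID; exfalso; apply: ID; apply/mem_set; rewrite /D.
have unE : un t = signatures U I by case/and4P: ct => _ _ _ /eqP.
by rewrite unE ct.
Qed.

End block_adjoint.

(** * Comparison of the two hierarchies *)

(** Compactness of the parameter space makes continuity in the first variable
    uniform in the second. *)
Lemma near_uniform (R : realType) (X Y : topologicalType) (f : X * Y -> R) (x : X) (e : R) :
  compact [set: Y] -> continuous f -> 0 < e ->
  \forall x' \near x, forall y, `|f (x', y) - f (x, y)| <= e.
Proof.
move=> /compact_near_coveringP cY cf e0.
have e2 : 0 < e / 2 by rewrite divr_gt0.
have := cY X (nbhs x) (fun x' y => `|f (x', y) - f (x, y)| <= e) (nbhs_filter x).
move=> H; suff Hy : forall y : Y, setT y ->
    \forall y' \near y & x' \near x, `|f (x', y') - f (x, y')| <= e.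
  by apply: (@filterS _ (nbhs x) _ _ _ _ (H Hy)) => x' fx' y; exact: (fx' y).
move=> y _.
have /cvgrPdist_lt/(_ _ e2) [[A B] /= [Ax By] AB] := cf (x, y).
exists (B, A) => // -[y' x'] /= [By' Ax'].
have h1 := AB (x', y') (conj Ax' By'); have h2 := AB (x, y') (conj (nbhs_singleton Ax) By').
rewrite /= in h1 h2; apply/ltW; rewrite [e]splitr.
rewrite -(subrKA (f (x, y))) (le_lt_trans (ler_normD _ _))// ltrD//.
by rewrite distrC.
Qed.

Section approximation.
Context {R : realType} {V : ptopologicalType} {E : set (V * V)}.
Hypotheses (packE : packing_graph E) (compactV : compact [set: V]).

(** Choose an open clique around each point of [Q0], and take the sets that are
    covered by these cliques and meet all of them.  A point of [Q1] then shares a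
    clique with a point of [Q2]; in a common independent set the two coincide. *)
Lemma near_separated n (Q0 : Ind E n) : exists2 N, nbhs Q0 N &
  forall m (I : Ind E m) Q1 Q2, N Q1 -> N Q2 -> (elts Q1 `<=` elts I)%fset ->
    (elts Q2 `<=` elts I)%fset -> Q1 = Q2.
Proof.
have /choice[U UP] x : exists U : set V, [/\ open U, clique E U & U x].
  have [|U [oU cU] xU] := open_clique packE (finite_set1 x).
    by move=> ? ? /= -> ->.
  by exists U; split => //; exact: xU.
exists ([set Q | forall x, x \in elts Q -> (\bigcup_(x0 in [set` elts Q0]) U x0) x] `&`
  \bigcap_(x0 in [set` elts Q0]) [set Q : Ind E n | exists2 x, x \in elts Q & U x0 x]).
  apply: filterI.
    apply: open_nbhs_nbhs; split.
      by apply: open_inside => //; apply: bigcup_open => x _; have [] := UP x.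
    by move=> x xQ; exists x => //; have [] := UP x.
  apply: filter_bigI => x xQ; apply: open_nbhs_nbhs; split.
    by apply: open_meets => //; have [] := UP x.
  by exists x => //; have [] := UP x.
move=> m I Q1 Q2 [in1 me1] [in2 me2] /fsubsetP Q1I /fsubsetP Q2I.
have sub (Q Q' : Ind E n) : {subset elts Q <= elts I} -> {subset elts Q' <= elts I} ->
    (forall x, x \in elts Q -> (\bigcup_(x0 in [set` elts Q0]) U x0) x) ->
    (\bigcap_(x0 in [set` elts Q0]) [set Q : Ind E n | exists2 x, x \in elts Q & U x0 x]) Q' ->
    (elts Q `<=` elts Q')%fset.
  move=> QI Q'I inQ meQ'; apply/fsubsetP => x xQ; have [x0 x0Q Ux] := inQ x xQ.
  have [y yQ' Uy] := meQ' x0 x0Q; suff -> : x = y by [].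
  apply: contrapT => xy; apply: (elts_indep (QI _ xQ) (Q'I _ yQ')).
  by have [_ cU _] := UP x0; exact: cU.
by apply: elts_inj; apply/eqP; rewrite eqEfsubset !sub.
Qed.

(** On the support of [phi i] the point [x] may be replaced by [p i] in [f] at cost
    [e], while [P] keeps the supports separated. *)
Lemma exists_fine_partition (X Y : ptopologicalType) (f : X * Y -> R) (P : X -> set X) (e : R) :
  hausdorff_space X -> compact [set: X] -> compact [set: Y] -> continuous f ->
  0 < e -> (forall x, nbhs x (P x)) ->
  exists (T : finType) (p : T -> X) (phi : T -> X -> R),
    [/\ forall i, continuous (phi i), forall i x, 0 <= phi i x,
        forall x, \sum_i phi i x = 1 &
        forall i x, phi i x != 0 ->
          P (p i) x /\ forall y, `|f (p i, y) - f (x, y)| <= e].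
Proof.
move=> hX cX cY cf e0 nP.
have nO x : nbhs x (P x `&` [set x' | forall y, `|f (x', y) - f (x, y)| <= e]).
  by apply: filterI => //; exact: near_uniform.
have [T [p [phi [cphi phi0 phiO phi1]]]] := partition_of_unity R hX cX nO.
exists T, p, phi; split => // i x /phiO[Px fx]; split => // y.
by rewrite distrC.
Qed.

Section glue.
Context {L : finType} (T : {set L}) (c k : nat).
Hypothesis ck : (c.+1 <= k)%N.

Definition glue_ok (p : {set L} * {set L}) := (#|p.1| <= 1)%N && (#|p.2| <= c)%N.

(** Choosing [S] and [S'] with union [T] and then decomposing each is choosing the
    two decompositions; [c.+1 <= k] makes every union [S] admissible. *)
Lemma sum_glue (W : {set L} * {set L} -> {set L} * {set L} -> R) :
  \sum_(A | cover2 k k T A) \sum_(p | cover2 1 c A.1 p) \sum_(q | cover2 1 c A.2 q) W p q =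
  \sum_(p | glue_ok p) \sum_(q | glue_ok q && (p.1 :|: p.2 :|: (q.1 :|: q.2) == T)%SET) W p q.
Proof.
rewrite [RHS](pair_big_dep glue_ok (fun p q => glue_ok q && (p.1 :|: p.2 :|: (q.1 :|: q.2) == T)%SET) W) /=.
rewrite [RHS](partition_big (fun pq => (pq.1.1 :|: pq.1.2, pq.2.1 :|: pq.2.2)%SET)
  (cover2 k k T)) /=; last first.
  move=> [[A B] [A' B']] /= /and3P[/andP[/= A1 Bc] /andP[/= A'1 B'c] UT].
  rewrite /cover2 /= UT andbT; apply/andP; split.
    by rewrite (leq_trans (leq_card_setU _ _))// (leq_trans _ ck)// -add1n leq_add.
  by rewrite (leq_trans (leq_card_setU _ _))// (leq_trans _ ck)// -add1n leq_add.
apply: eq_bigr => -[A A'] /and3P[/= _ _ /eqP AT].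
rewrite pair_big_dep /=; apply: eq_bigl => -[[B C] [B' C']] /=.
rewrite /cover2 /glue_ok /= xpair_eqE.
case: (_ <= 1)%N => //=; case: (_ <= c)%N => //=; case: (_ <= 1)%N; rewrite ?andbF//=.
case: (_ <= c)%N; rewrite ?andbF//=.
case: eqP => [->|]; rewrite ?andbF//=; case: eqP => [->|]; rewrite ?andbF//=.
by rewrite AT eqxx.
Qed.

(** The terms with [B = B'] are the decompositions in three parts. *)
Lemma sum_glue_diag (W : {set L} * {set L} -> {set L} * {set L} -> R) :
  (forall A B A' B' : {set L}, B \subset T -> B' \subset T -> (#|B| <= c)%N -> (#|B'| <= c)%N ->
    B != B' -> W (A, B) (A', B') = 0) ->
  \sum_(p | glue_ok p) \sum_(q | glue_ok q && (p.1 :|: p.2 :|: (q.1 :|: q.2) == T)%SET) W p q =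
  \sum_(t | cover3 1 1 c T t) W (t.1.1, t.2) (t.1.2, t.2).
Proof.
move=> W0.
rewrite (pair_big_dep glue_ok (fun p q => glue_ok q && (p.1 :|: p.2 :|: (q.1 :|: q.2) == T)%SET) W) /=.
rewrite (bigID (fun pq => pq.1.2 == pq.2.2)) /= [X in _ + X]big1 ?addr0; last first.
  move=> [[A B] [A' B']] /= /andP[/and3P[/andP[/= _ Bc] /andP[/= _ B'c] /eqP UT] BB'].
  apply: W0 => //; first by rewrite -UT finset.subsetU// finset.subsetUr.
  by rewrite -UT finset.subsetU// finset.subsetUr orbT.
rewrite (reindex_onto (fun t : {set L} * {set L} * {set L} => ((t.1.1, t.2), (t.1.2, t.2)))
  (fun pq => (pq.1.1, pq.2.1, pq.1.2))) /=; last first.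
  by move=> [[A B] [A' B']] /= /andP[_ /eqP ->].
apply: eq_bigl => -[[A A'] B] /=; rewrite !eqxx !andbT /glue_ok /cover3 /=.
have -> : (A :|: B :|: (A' :|: B) = B :|: A :|: A')%SET.
  by rewrite finset.setUACA finset.setUid finset.setUC finset.setUA.
by case: (_ <= 1)%N; case: (_ <= c)%N; case: (_ <= 1)%N; rewrite ?andbF.
Qed.

End glue.

(** The triple products of weights are again weights of total mass one. *)
Lemma sum_weights_dist (T1 T2 : finType) (phi : T1 -> R) (chi psi : T2 -> R)
    (f : T1 -> T2 -> T2 -> R) (y e : R) :
  (forall i, 0 <= phi i) -> (forall i, 0 <= chi i) -> (forall i, 0 <= psi i) ->
  \sum_i phi i = 1 -> \sum_i chi i = 1 -> \sum_i psi i = 1 ->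
  (forall i l m, phi i != 0 -> chi l != 0 -> psi m != 0 -> `|f i l m - y| <= e) ->
  `|(\sum_i \sum_l \sum_m f i l m * (phi i * chi l * psi m)) - y| <= e.
Proof.
move=> phi0 chi0 psi0 phi1 chi1 psi1 fe.
have sumE (z : R) : \sum_i \sum_l \sum_m z * (phi i * chi l * psi m) = z.
  under eq_bigr => i _.
    under eq_bigr => l _ do rewrite -mulr_sumr -mulr_sumr psi1 mulr1.
    rewrite -mulr_sumr -mulr_sumr chi1 mulr1; over.
  by rewrite -mulr_sumr phi1 mulr1.
rewrite -[X in _ - X]sumE -[leRHS]sumE.
rewrite -sumrB (le_trans (ler_norm_sum _ _ _))// ler_sum// => i _.
rewrite -sumrB (le_trans (ler_norm_sum _ _ _))// ler_sum// => l _.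
rewrite -sumrB (le_trans (ler_norm_sum _ _ _))// ler_sum// => m _.
rewrite -mulrBl normrM [X in _ * X <= _]ger0_norm ?mulr_ge0//.
have [->|i0] := eqVneq (phi i) 0; first by rewrite !(mul0r, mulr0).
have [->|l0] := eqVneq (chi l) 0; first by rewrite !(mul0r, mulr0).
have [->|m0] := eqVneq (psi m) 0; first by rewrite !(mul0r, mulr0).
by rewrite ler_wpM2r ?mulr_ge0// fe.
Qed.

(** For fixed [Q] the kernel [F (., ., Q)] is lifted to pairs of larger sets by
    summing over their decompositions.  Gluing these lifts along [Q] needs a
    kernel that is [1] on the diagonal and vanishes at distinct [Q], [Q'] inside
    a common independent set; a partition of unity [phi] subordinate to separated
    neighbourhoods provides [sum_i sqrt (phi_i Q) * sqrt (phi_i Q')].  A second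
    partition of unity keeps the lift continuous and positive semidefinite at the
    price of a uniformly small error. *)
Lemma exists_psd_lift c k (F : Ind E 1 * Ind E 1 * Ind E c -> R) (e : R) :
  (c < k)%N -> Csym3_psd (Ind E 1) (Ind E c) F -> 0 < e ->
  exists2 G, Csym_psd (Ind E k) G &
    forall n (I : Ind E n),
      `|\sum_(p \in fiber2 (elts I)) G p - \sum_(t \in fiber3 (elts I)) F t|
        <= (8 ^ n)%:R * (3 * e).
Proof.
move=> ck [[cF symF] psdF] e0.
have hI n := hausdorff_Ind packE (n := n); have cI n := @compact_Ind _ _ packE compactV n.
pose fQ (x : Ind E c * (Ind E 1 * Ind E 1)) : R := F (x.2, x.1).
pose fJ (x : Ind E 1 * (Ind E 1 * Ind E c)) : R := F (x.1, x.2.1, x.2.2).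
have cfQ : continuous fQ.
  apply: (continuous_comp_fun (f := fun x : Ind E c * (Ind E 1 * Ind E 1) => (x.2, x.1))) => //.
  by move=> x; exact: (cvg_pair cvg_snd cvg_fst).
have cfJ : continuous fJ.
  apply: (continuous_comp_fun (f := fun x : Ind E 1 * (Ind E 1 * Ind E c) => (x.1, x.2.1, x.2.2))) => //.
  have c21 : continuous (fun x : Ind E 1 * (Ind E 1 * Ind E c) => x.2.1).
    by apply: (continuous_comp_fun (f := snd) (g := fst)) => x; [exact: cvg_snd|exact: cvg_fst].
  have c22 : continuous (fun x : Ind E 1 * (Ind E 1 * Ind E c) => x.2.2).
    by apply: (continuous_comp_fun (f := snd) (g := snd)) => x; exact: cvg_snd.
  have c1 : continuous (fun x : Ind E 1 * (Ind E 1 * Ind E c) => (x.1, x.2.1)).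
    by move=> x; exact: (cvg_pair cvg_fst (c21 x)).
  by move=> x; exact: (cvg_pair (c1 x) (c22 x)).
have /choice[P PP] (Q : Ind E c) : exists N : set (Ind E c), nbhs Q N /\
  forall m (I : Ind E m) Q1 Q2, N Q1 -> N Q2 -> (elts Q1 `<=` elts I)%fset ->
    (elts Q2 `<=` elts I)%fset -> Q1 = Q2.
  by have [N nN NP] := near_separated Q; exists N.
have nP Q : nbhs Q (P Q) by have [] := PP Q.
have [T1 [q [phi [cphi phi0 phi1 phiP]]]] :=
  exists_fine_partition (hI c) (cI c) (compact_prod (cI 1) (cI 1)) cfQ e0 nP.
have [T2 [j [chi [cchi chi0 chi1 chiP]]]] :=
  exists_fine_partition (hI 1) (cI 1) (compact_prod (cI 1) (cI c)) cfJ e0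
    (fun x => filterT).
(* Square roots make the diagonal value [sum_i psi i Q * psi i Q] equal to one. *)
pose psi i Q := Num.sqrt (phi i Q).
have cpsi i : continuous (psi i).
  by apply: (continuous_comp_fun (cphi i)); exact: sqrt_continuous.
pose Fi i l m := F (j l, j m, q i).
pose h i l (p : Ind E 1 * Ind E c) : R := chi l p.1 * psi i p.2.
have ch i l : continuous (h i l).
  apply: continuous_mul.
    by apply: (continuous_comp_fun (f := fst)) => // x; exact: cvg_fst.
  by apply: (continuous_comp_fun (f := snd)) => // x; exact: cvg_snd.
pose g i l (S : Ind E k) : R := \sum_(p \in fiber2 (elts S)) h i l p.
have cg i l : continuous (g i l) by exact: continuous_fiber2_sum.
pose G (SS : Ind E k * Ind E k) : R :=
  \sum_i \sum_l \sum_m Fi i l m * (g i l SS.1 * g i m SS.2).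
exists G.
  split; first split.
  - apply: continuous_sum => i _; apply: continuous_sum => l _; apply: continuous_sum => m _.
    apply: continuous_mul; first exact: cst_continuous.
    apply: continuous_mul.
      by apply: (continuous_comp_fun (f := fst)) => // x; exact: cvg_fst.
    by apply: (continuous_comp_fun (f := snd)) => // x; exact: cvg_snd.
  - apply/funext => -[S S']; rewrite /G /=; apply: eq_bigr => i _.
    rewrite exchange_big /=; apply: eq_bigr => l _; apply: eq_bigr => m _.
    rewrite /Fi -[in LHS]symF /swap3 /swap /=; congr (_ * _); exact: mulrC.
  - move=> n x b.
    have -> : \sum_(s < n) \sum_(t < n) b s * b t * G (x s, x t) =
        \sum_i \sum_l \sum_m (\sum_(s < n) b s * g i l (x s)) *
          (\sum_(t < n) b t * g i m (x t)) * Fi i l m.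
      rewrite /G; under eq_bigr do under eq_bigr do rewrite mulr_sumr.
      under eq_bigr do rewrite exchange_big.
      rewrite exchange_big /=; apply: eq_bigr => i _.
      under eq_bigr do under eq_bigr do rewrite mulr_sumr.
      under eq_bigr do rewrite exchange_big.
      rewrite exchange_big /=; apply: eq_bigr => l _.
      under eq_bigr do under eq_bigr do rewrite mulr_sumr.
      under eq_bigr do rewrite exchange_big.
      rewrite exchange_big /=; apply: eq_bigr => m _.
      rewrite mulr_suml mulr_suml; apply: eq_bigr => s _.
      rewrite mulr_sumr mulr_suml; apply: eq_bigr => t _ /=; ring.
    apply: sumr_ge0 => i _; exact: (psd_fin j _ (psdF (q i))).
move=> n I; have [s [sI eI]] := enum_ind I.
set T := [set: 'I_(#|` elts I|)]%SET in eI; have sIT : {in T &, injective s} := in2W sI.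
pose p1 A := mkInd E 1 (pts s A); pose pc A := mkInd E c (pts s A).
rewrite (fiber2_sum sIT eI) (fiber3_sum sIT eI).
pose W (p p' : {set 'I_(#|` elts I|)} * {set 'I_(#|` elts I|)}) : R :=
  \sum_i \sum_l \sum_m Fi i l m * (h i l (p1 p.1, pc p.2) * h i m (p1 p'.1, pc p'.2)).
have gE i l (A : {set 'I_(#|` elts I|)}) : (#|A| <= k)%N -> g i l (mkInd E k (pts s A)) =
    \sum_(p | cover2 1 c A p) h i l (p1 p.1, pc p.2).
  move=> Ak; apply: fiber2_sum; first exact: in2W.
  by apply: (elts_sub_mkInd eI) => //; exact: finset.subsetT.
have -> : \sum_(A | cover2 k k T A) G (mkInd E k (pts s A.1), mkInd E k (pts s A.2)) =
    \sum_(A | cover2 k k T A) \sum_(p | cover2 1 c A.1 p) \sum_(p' | cover2 1 c A.2 p') W p p'.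
  apply: eq_bigr => -[A A'] /and3P[/= Ak A'k _]; rewrite /G /W /=.
  under [RHS]eq_bigr do rewrite exchange_big.
  rewrite [RHS]exchange_big /=; apply: eq_bigr => i _.
  under [RHS]eq_bigr do rewrite exchange_big.
  rewrite [RHS]exchange_big /=; apply: eq_bigr => l _.
  under [RHS]eq_bigr do rewrite exchange_big.
  rewrite [RHS]exchange_big /=; apply: eq_bigr => m _.
  rewrite !gE// mulr_suml mulr_sumr; apply: eq_bigr => p _.
  by rewrite mulr_sumr mulr_sumr.
(* If [psi i] is nonzero at two subsets of [I], then these are equal. *)
rewrite sum_glue// sum_glue_diag; last first.
  move=> A B A' B' BT B'T Bc B'c BB'; rewrite /W; apply: big1 => i _; apply: big1 => l _.
  apply: big1 => m _; rewrite /h /=.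
  suff [-> | ->] : psi i (pc B) = 0 \/ psi i (pc B') = 0 by rewrite !(mul0r, mulr0).
  apply: contrapT => /not_orP[/eqP B0 /eqP B'0].
  have phiN Q : psi i Q != 0 -> phi i Q != 0.
    by apply: contraNneq => Q0; rewrite /psi Q0 sqrtr0.
  have [PB _] := phiP _ _ (phiN _ B0); have [PB' _] := phiP _ _ (phiN _ B'0).
  have sub (D : {set 'I_(#|` elts I|)}) : D \subset T -> (#|D| <= c)%N ->
      elts (pc D) = pts s D /\ (elts (pc D) `<=` elts I)%fset.
    move=> DT Dc; have eD : elts (pc D) = pts s D by exact: (elts_sub_mkInd eI).
    split => //; rewrite eD; apply/fsubsetP => x /in_ptsP[l' l'D ->].
    suff : s l' \in pts s T by rewrite -eI.
    by apply: mem_pts; exact: (fintype.subsetP DT).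
  have [_ /(_ _ I _ _ PB PB')] := PP (q i).
  move=> /(_ (sub _ BT Bc).2 (sub _ B'T B'c).2) /(congr1 (@elts _ _ _)).
  rewrite (sub _ BT Bc).1 (sub _ B'T B'c).1 => /(pts_inj sIT BT B'T).
  by move/eqP; rewrite (negbTE BB').
rewrite -sumrB; apply: le_trans (ler_norm_sum _ _ _) _.
(* One [e] for each of the arguments [Q], [J] and [J'] that is replaced by a
   centre of a partition of unity. *)
apply: (@le_trans _ _ (\sum_(t | cover3 1 1 c T t) 3 * e)).
  apply: ler_sum => -[[A A'] B] _ /=.
  have -> : W (A, B) (A', B) = \sum_i \sum_l \sum_m Fi i l m *
      (phi i (pc B) * chi l (p1 A) * chi m (p1 A')).
    apply: eq_bigr => i _; apply: eq_bigr => l _; apply: eq_bigr => m _.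
    rewrite /h /= -{1}(sqr_sqrtr (phi0 i (pc B))) -/(psi i (pc B)); ring.
  apply: sum_weights_dist => // i l m /phiP[_ hB] /chiP[_ hA] /chiP[_ hA'].
  have {}hB := hB (j l, j m); have {}hA := hA (j m, pc B); have {}hA' := hA' (p1 A, pc B).
  rewrite /fQ /fJ /= in hB hA hA'.
  have swF J J' Q : F (J, J', Q) = F (J', J, Q) by rewrite -[in LHS]symF.
  rewrite (swF (j m) (p1 A)) (swF (p1 A') (p1 A)) in hA'.
  rewrite /Fi (_ : _ - _ = (F (j l, j m, q i) - F (j l, j m, pc B)) +
    ((F (j l, j m, pc B) - F (p1 A, j m, pc B)) +
     (F (p1 A, j m, pc B) - F (p1 A, p1 A', pc B)))); last by ring.
  rewrite (_ : 3 * e = e + (e + e)); last by ring.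
  apply: le_trans (ler_normD _ _) _; apply: lerD => //.
  by apply: le_trans (ler_normD _ _) _; apply: lerD.
rewrite sumr_const -[leLHS]mulr_natl ler_wpM2r// ?mulr_ge0 ?(ltW e0)//.
(* There are at most [2 ^ n] choices for each of the three subsets of [I]. *)
rewrite ler_nat (leq_trans (max_card _))// !card_prod -cardsT -powersetT card_powerset.
by rewrite cardsT card_ord -!expnMn leq_pexp2l// card_elts.
Qed.

End approximation.

Section moment_le_block.
Context {R : realType} {V : ptopologicalType} {E : set (V * V)}.
Hypotheses (packE : packing_graph E) (compactV : compact [set: V]).

Definition resize n {m} (I : Ind E m) : Ind E n := mkInd E n (elts I).

Definition at_most n {m} : set (Ind E m) := [set I | (#|` elts I| <= n)%N].

Lemma elts_resize n m (I : Ind E m) : at_most n I -> elts (resize n I) = elts I.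
Proof. by move=> In; apply: elts_mkInd; split => //; exact: elts_indep. Qed.

Lemma continuous_resize n m : {within (@at_most n m), continuous (@resize n m)}.
Proof.
apply/continuousP => W oW; apply/open_subspaceP.
exists (@at_most n m `&` resize n @^-1` W); last by rewrite setIC setIA setIid setIC.
apply: (open_Ind packE) => v vi [vn Wv].
have [S SP] := exists_reps v; have [vI vS] := SP v (fun _ _ => erefl).
have ev : elts (indt E v) = pts v S by rewrite elts_indt.
have Sn : (#|S| <= n)%N by rewrite -(card_pts vI (fintype.subxx S)) -ev.
have WS : nbhs (mkInd E n (pts v S)) W by rewrite -ev; apply: open_nbhs_nbhs.
apply: filterS2 (near_pattern packE v) (near_mkInd vi Sn WS) => w wv wW wi.
have [wI wS] := SP w (wv wi).
have ew : elts (indt E w) = pts w S by rewrite elts_indt.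
split; last by rewrite /resize /= ew; exact: wW.
by rewrite /at_most /= ew (card_pts wI (fintype.subxx S)).
Qed.

(** Restricting a feasible measure of the moment hierarchy to small independent
    sets gives a feasible measure of the block hierarchy: the block positivity is
    tested by lifting block kernels to kernels on pairs of larger sets. *)
Lemma moment_le_block n k : (2 <= n)%N -> (n - 2 < k)%N ->
  (moment R E k <= block_moment R E n)%E.
Proof.
move=> n2 ck; apply: ge_ereal_sup => _ [nu [rnu nu0 nu1 [mu [_ mupos] adj]] <-].
have hI m := hausdorff_Ind packE (n := m); have cI m := @compact_Ind _ _ packE compactV m.
pose D (_ : 'I_1) : set (borel (Ind E (2 * k))) := @at_most n (2 * k).
have mD i : measurable (D i).
  by apply: open_borel; exact: (@open_card _ _ packE (2 * k) (fun j => (j <= n)%N)).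
have [nu' [nu'0 rnu' nu'E nu'I]] := radon_push (hI _) (hI n) (cI n) nu0 rnu mD
  (rho := fun _ => @resize n (2 * k)) (fun _ => @continuous_resize n (2 * k)).
have nu'k j : (j <= n)%N -> nu' (ind_eq j) = nu (ind_eq j).
  move=> jn; rewrite nu'E ?big_ord1; last exact: measurable_ind_eq.
  congr (nu _); apply/seteqP; split => [I [In]|I Ij].
    by rewrite /ind_eq /= elts_resize.
  have In : at_most n I by rewrite /at_most /= Ij.
  by split => //; rewrite /ind_eq /= elts_resize.
rewrite -nu'k; last exact: ltnW.
apply: ereal_sup_ubound; exists nu' => //; split => //.
  by rewrite -ind_eq0 nu'k// ind_eq0.
have [mu' [mu'0 mu'sym mu'I]] := exists_block_adjoint packE compactV 1 (n - 2) nu'0 rnu'.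
exists mu'; last by move=> F CF; rewrite mu'I//; exact: CF.1.
split => // F CF; have [[cF symF] psdF] := CF; rewrite mu'I//.
pose H (I : Ind E (2 * k)) : R := \sum_(t \in @fiber3 V E 1 1 (n - 2) (elts I)) F t.
have cH : continuous H by exact: continuous_fiber3_sum.
(* Sets with more than [n] points have no decomposition into parts of sizes
   [1], [1] and [n - 2], so restricting [nu] does not change the integral. *)
have -> : pairing nu' (fun I => \sum_(t \in fiber3 (elts I)) F t) = pairing nu H.
  rewrite nu'I; last exact: continuous_fiber3_sum.
  congr pairing; apply/funext => I; rewrite /push_density big_ord1 /patch /H.
  have [/set_mem In|nIn] := boolP (I \in D ord0); first by rewrite /= elts_resize.
  rewrite (_ : fiber3 (elts I) = set0) ?fsbig_set0//.
  apply/seteqP; split => // -[[J J'] Q] /= tI; move/negP: nIn; apply; apply/mem_set.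
  rewrite /D /at_most /= -tI.
  apply: leq_trans (leq_card_fsetU _ _) _.
  apply: (@leq_trans (n - 2 + 1 + 1)%N); last by rewrite -addnA subnK.
  rewrite leq_add ?card_elts//; apply: leq_trans (leq_card_fsetU _ _) _.
  by rewrite leq_add ?card_elts.
rewrite leNgt; apply/negP => H0.
pose M := fine (nu setT); pose C : R := (8 ^ (2 * k))%:R * 3.
have M0 : 0 <= M by rewrite fine_ge0// nu0.
have C0 : 0 < C by rewrite mulr_gt0// ltr0n expn_gt0.
(* The lifting error costs at most [C * e * M], which this [e] keeps below half of
   the supposed negative value; [M + 1] avoids dividing by zero. *)
pose e := - pairing nu H / (2 * (C * (M + 1))).
have e0 : 0 < e by rewrite divr_gt0 ?oppr_gt0// !mulr_gt0// ltr_wpDl.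
have [G CG GH] := exists_psd_lift packE compactV ck CF e0.
have := mupos G CG; rewrite (adj _ CG.1) leNgt; move/negP; apply.
have cA : continuous (opA (r := k) G) by apply: (continuous_fiber2_sum packE); exact: CG.1.1.
apply: (@le_lt_trans _ _ (pairing nu (fun I => C * e * 1 + H I))).
  apply: (le_pairing nu0 (cI _) cA) => [|I].
    by apply: continuous_add => //; exact: cst_continuous.
  rewrite mulr1 -lerBlDr; apply: le_trans (ler_norm _) _.
  by apply: le_trans (GH _ I) _; rewrite mulrA.
rewrite (pairing_linear nu0 (cI _))//; last exact: cst_continuous.
rewrite pairing_cst// mul1r -/M.
suff : C * e * M < - pairing nu H by rewrite -subr_lt0 opprK.
apply: (@le_lt_trans _ _ (- pairing nu H / 2)).
  have -> : C * e * M = - pairing nu H / 2 * (M / (M + 1)).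
    have M1 : M + 1 != 0 by rewrite lt0r_neq0// ltr_wpDl.
    have C1 : C != 0 by exact: lt0r_neq0.
    rewrite /e; move: (pairing nu H) => x; clearbody C M; field.
    by rewrite C1 M1.
  rewrite ler_piMr ?divr_ge0 ?oppr_ge0 ?(ltW H0)//.
  by rewrite ler_pdivrMr ?mul1r ?lerDl// ltr_wpDl.
by rewrite ltr_pdivrMr// ltr_pMr ?oppr_gt0// ltr1n.
Qed.

End moment_le_block.

(** * The comparison theorem *)

Theorem theorem7p9 (R : realType) (V : ptopologicalType) (E : set (V * V))
    (packE : packing_graph E) (compactV : compact [set: V])
    (metrV : metrizable R V) :
  (forall r : nat, (1 <= r)%N ->
     (moment R E r.+1 <= block_moment R E r.+2)%E /\
     (block_moment R E r.+2 <= theta E (Msym_dual (Ccop R V r)))%E) /\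
  (forall r : nat, (indep_number E + 2 <= r)%N ->
     ((indep_number E)%:R)%:E = block_moment R E r /\
     block_moment R E r = moment R E (r - 1)).
Proof.
split=> [r r1|r ar].
  split; first by apply: moment_le_block => //; rewrite subn2.
  have [ar|ra] := leqP (r.+2) (indep_number E).
    by rewrite theta_pinfty// leey.
  apply: le_trans (block_moment_le_indep packE compactV ra) _.
  exact: theta_ge_indep.
have le_block : (moment R E (r - 1) <= block_moment R E r)%E.
  by apply: moment_le_block => //; lia.
have le_moment : ((indep_number E)%:R%:E <= moment R E (r - 1))%E.
  by apply: indep_le_moment => //; lia.
have le_indep : (block_moment R E r <= (indep_number E)%:R%:E)%E.
  by apply: block_moment_le_indep => //; lia.
split; apply/eqP; rewrite eq_le.
  by rewrite le_indep andbT (le_trans le_moment).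
by rewrite le_block andbT (le_trans le_indep).
Qed.
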